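(* Let $n\ge1$, $K=\mathrm U_{2n}$, $l,L\in\mathbb Z$, and let $N_1\ge N_2\ge\cdots\ge N_n$ be integers with $N_n\ge|l+L|$. Let $\pi_K\subset C^\infty(K)$ be the space of smooth $f$ with $f(tk)=\prod_{i=1}^n\chi_{N_i+L}(t_{2i-1})\chi_{-N_i+L}(t_{2i})f(k)$ for $t=\mathrm{diag}(t_1,\dots,t_{2n})\in T\cap K$, with $K$ acting by right translation. Then the function $\iota(F_{\vec N,l,L}):k\mapsto F_{\vec N,l,L}(k)$ lies in $\pi_K$, lies in the minimal $K$-type $\tau$ of $\pi_K$ (the irreducible constituent of highest weight $\Lambda=(N_1+L,\dots,N_n+L,-N_n+L,\dots,-N_1+L)$), and satisfies $\iota(F_{\vec N,l,L})\big(k\,\mathrm{diag}(k_1,k_2)\big)=\chi_{-l}(\det k_1)\chi_{l+2L}(\det k_2)\,\iota(F_{\vec N,l,L})(k)$ for all $k\in K$, $k_1,k_2\in\mathrm U_n$.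
   Context: $T\cap K$ is the group of diagonal unitary matrices; $\chi_N(z)=(z/|z|)^N$. For $Z=(z_{a,b})\in M_{2n}(\mathbb C)$: $u_j=(z_{j,1},\dots,z_{j,n})$, $\bar u_j$ its conjugate, $\Phi_{jl}(Z)=\sum_{i=1}^n z_{j,i}\bar z_{l,i}$; $F_k=\sum_s\mathrm{sgn}(s)\prod_{i=1}^k\Phi_{2i-1,s(2i-1)+1}$ over permutations $s$ of $\{1,3,\dots,2k-1\}$; $\Delta_{1,+}(Z)=\det(\text{rows }u_1,u_3,\dots,u_{2n-1})$, $\Delta_{1,-}(Z)=\det(\text{rows }\bar u_2,\bar u_4,\dots,\bar u_{2n})$, $\Delta_{2,+}=\det Z$, $\Delta_{2,-}=\det\bar Z$. Define $F_{\vec N,l,L}=\big(\prod_{i=1}^{n-1}F_i^{N_i-N_{i+1}}\big)F_n^{N_n-|l+L|}D_1D_2$ with $D_1=\Delta_{1,-}^{2(l+L)}$ if $l+L\ge0$, $D_1=\Delta_{1,+}^{-2(l+L)}$ if $l+L\le0$, $D_2=\Delta_{2,+}^{l+2L}$ if $l+2L\ge0$, $D_2=\Delta_{2,-}^{-(l+2L)}$ if $l+2L\le0$. *)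

(* Defs.v *)
(* mathcomp + mathcomp-analysis + real_closed (complex R = R[i]) *)
From mathcomp Require Import all_boot all_order all_algebra.
From mathcomp Require Import all_classical all_reals all_analysis.
From mathcomp Require Import complex.
From mathcomp Require Import fingroup perm.
Set Implicit Arguments. Unset Strict Implicit. Unset Printing Implicit Defensive.
Import Order.TTheory GRing.Theory Num.Theory.
Import numFieldNormedType.Exports.
Local Open Scope ring_scope.

(* Unitary group U_m inside M_m(C), C = R[i]                            *)

(* conjugate transpose *)
Definition ctmx (R : realType) (m : nat) (M : 'M[R[i]]_m) : 'M[R[i]]_m :=
  (map_mx Num.conj M)^T.

Definition unitary_mx (R : realType) (m : nat) (M : 'M[R[i]]_m) : Prop :=
  M *m ctmx M = 1%:M.

(* the group U_m, as a subtype of matrices *)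
Definition Ugrp (R : realType) (m : nat) := {M : 'M[R[i]]_m | unitary_mx M}.

Lemma unitary_mx_mul (R : realType) (m : nat) (A B : 'M[R[i]]_m) :
  unitary_mx A -> unitary_mx B -> unitary_mx (A *m B).
Proof.
rewrite /unitary_mx /ctmx => hA hB.
rewrite map_mxM trmx_mul mulmxA -(mulmxA A B) hB mulmx1 //.
Qed.

Definition Umul (R : realType) (m : nat) (k g : Ugrp R m) : Ugrp R m :=
  exist _ (proj1_sig k *m proj1_sig g) (unitary_mx_mul (proj2_sig k) (proj2_sig g)).

(* chi_N(z) = (z/|z|)^N *)
Definition chi (R : realType) (N : int) (z : R[i]) : R[i] := (z / `|z|) ^ N.

(* entries of a matrix indexed by (0-based) natural numbers, 0 outside *)
Definition ent (R : realType) (m : nat) (Z : 'M[R[i]]_m) (a b : nat) : R[i] :=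
  match (insub a : option 'I_m), (insub b : option 'I_m) with
  | Some i, Some j => Z i j
  | _, _ => 0
  end.

(* The polynomial functions of the paper (1-based indices of the paper *)
(* are translated to 0-based: paper row j  <->  ent row j-1).          *)

(* Phi_{jl}(Z) = sum_{i=1}^n z_{j,i} conj(z_{l,i}), with 0-based j l *)
Definition Phi (R : realType) (n m : nat) (Z : 'M[R[i]]_m) (j l : nat) : R[i] :=
  \sum_(i < n) ent Z j i * (ent Z l i)^*.

(* F_k = sum_s sgn(s) prod_{i=1}^k Phi_{2i-1, s(2i-1)+1}, s a permutation of
   {1,3,...,2k-1}; writing 2i-1 = 2i'+1 (i' < k) and s(2i'+1) = 2 sigma(i') + 1,
   the paper's row indices 2i-1 and s(2i-1)+1 are the 0-based rows 2i' and
   2 sigma(i') + 1. *)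
Definition Fk (R : realType) (n m : nat) (k : nat) (Z : 'M[R[i]]_m) : R[i] :=
  \sum_(s : 'S_k) (-1) ^+ s * \prod_(i < k) Phi n Z (2 * i) (2 * s i + 1).

(* Delta_{1,+} = det(rows u_1, u_3, ..., u_{2n-1}) *)
Definition Delta1p (R : realType) (n m : nat) (Z : 'M[R[i]]_m) : R[i] :=
  \det (\matrix_(i < n, j < n) ent Z (2 * i) j).
(* Delta_{1,-} = det(rows conj u_2, ..., conj u_{2n}) *)
Definition Delta1m (R : realType) (n m : nat) (Z : 'M[R[i]]_m) : R[i] :=
  \det (\matrix_(i < n, j < n) (ent Z (2 * i + 1) j)^*).
Definition Delta2p (R : realType) (m : nat) (Z : 'M[R[i]]_m) : R[i] := \det Z.
Definition Delta2m (R : realType) (m : nat) (Z : 'M[R[i]]_m) : R[i] :=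
  \det (map_mx Num.conj Z).

(* N is the 0-based sequence: paper N_i = N (i-1) *)
Definition FNlL (R : realType) (n : nat) (N : nat -> int) (l L : int)
    (Z : 'M[R[i]]_(n + n)) : R[i] :=
  (\prod_(i < n.-1) Fk n (i.+1) Z ^ (N i - N i.+1)) *
  Fk n n Z ^ (N n.-1 - `|l + L|) *
  (if 0 <= l + L then Delta1m n Z ^ (2 * (l + L)) else Delta1p n Z ^ (- (2 * (l + L)))) *
  (if 0 <= l + 2 * L then Delta2p Z ^ (l + 2 * L) else Delta2m Z ^ (- (l + 2 * L))).

(* iota(F) : K -> C, restriction to K *)
Definition iotaK (R : realType) (m : nat) (F : 'M[R[i]]_m -> R[i]) (k : Ugrp R m) : R[i] :=
  F (proj1_sig k).

(* Smooth functions on K: restrictions of C^infty functions on the      *)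
(* ambient real vector space M_m(C) = M_m(R) x M_m(R).                  *)

Fixpoint Ck (R : realType) (V : normedModType R) (k : nat) (g : V -> R) : Prop :=
  match k with
  | 0 => continuous g
  | k'.+1 => (forall x v : V, derivable g x v) /\ (forall v : V, Ck k' ('D_v g))
  end.

Definition Cinfty (R : realType) (V : normedModType R) (g : V -> R) : Prop :=
  forall k, Ck k g.

Definition smoothK (R : realType) (m : nat) (f : Ugrp R m -> R[i]) : Prop :=
  exists gre gim : 'M[R]_m * 'M[R]_m -> R,
    Cinfty gre /\ Cinfty gim /\
    forall k : Ugrp R m,
      let Z := proj1_sig k in
      let X := (map_mx (@complex.Re R) Z, map_mx (@complex.Im R) Z) in
      f k = Complex (gre X) (gim X).

(* The induced representation pi_K                                      *)

(* f(t k) = prod_i chi_{N_i+L}(t_{2i-1}) chi_{-N_i+L}(t_{2i}) f(k), t in T cap K *)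
Definition in_piK (R : realType) (n : nat) (N : nat -> int) (L : int)
    (f : Ugrp R (n + n) -> R[i]) : Prop :=
  smoothK f /\
  forall (t k : Ugrp R (n + n)), is_diag_mx (proj1_sig t) ->
    f (Umul t k) =
      (\prod_(i < n) (chi (N i + L) (ent (proj1_sig t) (2 * i) (2 * i)) *
                      chi (- N i + L) (ent (proj1_sig t) (2 * i + 1) (2 * i + 1)))) * f k.

(* right translation *)
Definition rtrans (R : realType) (m : nat) (g : Ugrp R m) (f : Ugrp R m -> R[i]) :
  Ugrp R m -> R[i] := fun k => f (Umul k g).

(* Finite dimensional K-subrepresentations, irreducibility, weights    *)

Definition Kfun (R : realType) (m : nat) := Ugrp R m -> R[i].

Definition is_subspace (R : realType) (m : nat) (S : Kfun R m -> Prop) : Prop :=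
  S (fun _ => 0) /\
  (forall f g, S f -> S g -> S (fun k => f k + g k)) /\
  (forall (c : R[i]) f, S f -> S (fun k => c * f k)).

Definition is_Kinvariant (R : realType) (m : nat) (S : Kfun R m -> Prop) : Prop :=
  forall (g : Ugrp R m) f, S f -> S (rtrans g f).

Definition is_findim (R : realType) (m : nat) (S : Kfun R m -> Prop) : Prop :=
  exists s : seq (Kfun R m),
    forall f, S f <-> exists c : 'I_(size s) -> R[i],
      f = (fun k => \sum_(j < size s) c j * nth (fun _ => 0) s j k).

Definition nonzero_fun (R : realType) (m : nat) (f : Kfun R m) : Prop :=
  exists k, f k <> 0.

(* finite dimensional K-subrepresentation of C(K) under right translation *)
Definition is_Ksubrep (R : realType) (m : nat) (S : Kfun R m -> Prop) : Prop :=
  is_subspace S /\ is_Kinvariant S /\ is_findim S.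

Definition is_irreducible (R : realType) (m : nat) (S : Kfun R m -> Prop) : Prop :=
  is_Ksubrep S /\ (exists f, S f /\ nonzero_fun f) /\
  forall S' : Kfun R m -> Prop,
    is_subspace S' -> is_Kinvariant S' -> (forall f, S' f -> S f) ->
    (forall f, S' f -> forall k, f k = 0) \/ (forall f, S f -> S' f).

(* mu is a weight of S (for the right action of the diagonal torus T cap K) *)
Definition is_weight (R : realType) (m : nat) (S : Kfun R m -> Prop) (mu : 'I_m -> int) :
  Prop :=
  exists w, S w /\ nonzero_fun w /\
    forall (t k : Ugrp R m), is_diag_mx (proj1_sig t) ->
      w (Umul k t) = (\prod_(a < m) (proj1_sig t a a) ^ (mu a)) * w k.

(* dominance order: Lambda - mu is a nonnegative combination of the positive
   roots e_a - e_b (a < b) *)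
Definition dominated (m : nat) (mu Lam : 'I_m -> int) : Prop :=
  (forall j : nat, (j <= m)%N ->
     \sum_(a < m | (a < j)%N) mu a <= \sum_(a < m | (a < j)%N) Lam a) /\
  \sum_(a < m) mu a = \sum_(a < m) Lam a.

(* irreducible representation with highest weight Lambda *)
Definition irr_highest_weight (R : realType) (m : nat) (S : Kfun R m -> Prop)
  (Lam : 'I_m -> int) : Prop :=
  is_irreducible S /\ is_weight S Lam /\
  forall mu, is_weight S mu -> dominated mu Lam.

(* Lambda = (N_1+L, ..., N_n+L, -N_n+L, ..., -N_1+L), 0-based *)
Definition LambdaW (n : nat) (N : nat -> int) (L : int) (a : 'I_(n + n)) : int :=
  if (a < n)%N then N a + L else - N (n + n - a.+1)%N + L.

(* f lies in the K-type tau of pi_K of highest weight Lambda *)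
Definition in_Ktype (R : realType) (n : nat) (N : nat -> int) (L : int)
    (f : Kfun R (n + n)) : Prop :=
  exists tau : Kfun R (n + n) -> Prop,
    (forall g, tau g -> in_piK N L g) /\
    irr_highest_weight tau (LambdaW N L) /\ tau f.

(* Main.v *)
Require Import Defs.
From mathcomp Require Import all_boot all_order all_algebra.
From mathcomp Require Import all_classical all_reals all_analysis.
From mathcomp Require Import complex.
From mathcomp Require Import fingroup perm.
From mathcomp Require Import ring zify.
Set Implicit Arguments. Unset Strict Implicit. Unset Printing Implicit Defensive.
Import Order.TTheory GRing.Theory Num.Theory.
Import numFieldNormedType.Exports.
Local Open Scope ring_scope.

(* Let P_(k,I) be the minor of Z on rows 1, 3, ..., 2k-1 and columns I, and Q_(k,I) the
   conjugate of the minor on rows 2, 4, ..., 2k.  By Cauchy-Binet, F is a combination of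
   the products e_j of such minors of the same shape as F.  All e_j have the same left
   weight, their right weights are dominated by Lambda, and those of weight Lambda are
   proportional to a single function.  Again by Cauchy-Binet,
   sum_j e_j(k) conj(e_j(h)) = kappa(k h^* ) for a function kappa on matrices, so that
   V = span(e_j) is also the span of the translates of kappa; in particular it is
   K-invariant.  A nonzero invariant subspace of V contains a function that does not
   vanish at the permutation matrix w which conjugates the left weight into Lambda; the
   value at w is carried by the component of right weight Lambda, hence the subspace
   contains the vector of weight Lambda, a translate of kappa, and so it is V.  Thus V
   is the irreducible representation of highest weight Lambda, and it contains F. *)

(** * Smooth functions on the unitary group *)

Section SmoothFunctions.
Variables (R : realType) (V : normedModType R).
Implicit Types f g : V -> R.

Lemma Cinfty_continuous f : Cinfty f -> continuous f.
Proof. by move/(_ 0%N). Qed.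

Lemma Cinfty_derivable f x v : Cinfty f -> derivable f x v.
Proof. by move/(_ 1%N) => [+ _]; exact. Qed.

Lemma Cinfty_derive f v : Cinfty f -> Cinfty ('D_v f).
Proof. by move=> hf k; have [_] := hf k.+1; exact. Qed.

Lemma Cinfty_cst (c : R) : Cinfty (fun _ : V => c).
Proof.
move=> k; elim: k c => [|k IH] c /=; first by move=> x; exact: cvg_cst.
split=> [x v|v]; first exact: derivable_cst.
have -> : 'D_v (fun _ : V => c) = fun _ => 0 by apply/funext => x; exact: derive_cst.
exact: IH.
Qed.

Lemma CkD k f g : Ck k f -> Ck k g -> Ck k (fun x => f x + g x).
Proof.
elim: k f g => [|k IH] f g /=; first by move=> hf hg x; apply: cvgD; [exact: hf | exact: hg].
move=> [df Df] [dg Dg]; split=> [x v|v]; first exact: derivableD.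
have -> : 'D_v (fun x => f x + g x) = fun x => 'D_v f x + 'D_v g x.
  by apply/funext => x; apply: deriveD.
exact: IH.
Qed.

Lemma CinftyD f g : Cinfty f -> Cinfty g -> Cinfty (fun x => f x + g x).
Proof. by move=> hf hg k; exact: CkD. Qed.

(** Products, unlike sums, are handled only at infinite order: the Leibniz rule keeps one factor
    undifferentiated, and [Ck k.+1] does not formally contain [Ck k]. *)
Lemma CinftyM f g : Cinfty f -> Cinfty g -> Cinfty (fun x => f x * g x).
Proof.
move=> hf hg k; elim: k f g hf hg => [|k IH] f g hf hg /=.
  by move=> x; apply: cvgM; exact: Cinfty_continuous.
split=> [x v|v]; first by apply: derivableM; exact: Cinfty_derivable.
have -> : 'D_v (fun x => f x * g x) = fun x => f x * 'D_v g x + g x * 'D_v f x.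
  by apply/funext => x; apply: deriveM; exact: Cinfty_derivable.
by apply: CkD; apply: IH => //; exact: Cinfty_derive.
Qed.

Lemma CinftyN f : Cinfty f -> Cinfty (fun x => - f x).
Proof.
move=> hf; have -> : (fun x => - f x) = (fun x => (fun=> -1) x * f x).
  by apply/funext => x; rewrite mulN1r.
by apply: CinftyM => //; exact: Cinfty_cst.
Qed.

(** The difference quotient in the direction [v] is the constant [f v], so the first derivative no
    longer depends on the point. *)
Lemma Cinfty_linear (f : V -> R) :
  linear f -> continuous f -> Cinfty f.
Proof.
move=> lf cf k.
have isd x v : is_derive x v f (f v).
  have E h : h != 0 -> h^-1 *: ((f \o shift x) (h *: v) - f x) = f v.
    by move=> h0; rewrite /= lf addrK scalerA mulVf // scale1r.
  apply: DeriveDef.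
    apply/cvg_ex; exists (f v); apply: cvg_near_cst; near=> h.
    apply: E; near: h; exact: nbhs_dnbhs_neq.
  apply: cvg_lim => //; apply: cvg_near_cst; near=> h.
  apply: E; near: h; exact: nbhs_dnbhs_neq.
case: k => [|k] /=; first exact: cf.
split=> [x v|v]; first by have [] := isd x v.
have -> : 'D_v f = fun _ => f v by apply/funext => x; exact: derive_val.
exact: Cinfty_cst.
Unshelve. all: by end_near.
Qed.

End SmoothFunctions.

Section SmoothOnGroup.
Variables (R : realType) (m : nat).
Implicit Types f g : Ugrp R m -> R[i].

Lemma smoothK_cst (c : R[i]) : smoothK (fun _ : Ugrp R m => c).
Proof.
exists (fun=> complex.Re c), (fun=> complex.Im c).
by split; [exact: Cinfty_cst | split; [exact: Cinfty_cst | case: c]].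
Qed.

Lemma smoothKD f g : smoothK f -> smoothK g -> smoothK (fun k => f k + g k).
Proof.
move=> [a [b [ha [hb E]]]] [c [d [hc [hd E']]]].
exists (fun x => a x + c x), (fun x => b x + d x).
split; first exact: CinftyD.
by split; [exact: CinftyD | move=> k /=; rewrite E E'].
Qed.

Lemma smoothKM f g : smoothK f -> smoothK g -> smoothK (fun k => f k * g k).
Proof.
move=> [a [b [ha [hb E]]]] [c [d [hc [hd E']]]].
exists (fun x => a x * c x + - (b x * d x)), (fun x => a x * d x + b x * c x).
split; first by apply: CinftyD; [|apply: CinftyN]; exact: CinftyM.
by split; [apply: CinftyD; exact: CinftyM | move=> k /=; rewrite E E'].
Qed.

Lemma smoothK_conj f : smoothK f -> smoothK (fun k => (f k)^*).
Proof.
move=> [a [b [ha [hb E]]]]; exists a, (fun x => - b x).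
by split=> //; split; [exact: CinftyN | move=> k /=; rewrite E].
Qed.

Lemma smoothK_entry i j : smoothK (fun k : Ugrp R m => proj1_sig k i j).
Proof.
exists (fun X : 'M[R]_m * 'M[R]_m => X.1 i j), (fun X : 'M[R]_m * 'M[R]_m => X.2 i j); split.
  apply: Cinfty_linear => [a u v|x]; first by rewrite /= !mxE.
  by apply: (continuous_comp (f := fst) (g := fun M : 'M[R]_m => M i j));
    [exact: cvg_fst | exact: coord_continuous].
split=> [|k /=]; last by rewrite !mxE; case: (proj1_sig k i j).
apply: Cinfty_linear => [a u v|x]; first by rewrite /= !mxE.
by apply: (continuous_comp (f := snd) (g := fun M : 'M[R]_m => M i j));
    [exact: cvg_snd | exact: coord_continuous].
Qed.

Lemma smoothK_sum (I : Type) (r : seq I) (P : pred I) (F : I -> Ugrp R m -> R[i]) :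
  (forall i, smoothK (F i)) -> smoothK (fun k => \sum_(i <- r | P i) F i k).
Proof.
move=> hF; elim: r => [|i r IH].
  have -> : (fun k => \sum_(i <- [::] | P i) F i k) = fun=> 0.
    by apply/funext => k; rewrite big_nil.
  exact: smoothK_cst.
have -> : (fun k => \sum_(j <- i :: r | P j) F j k) =
    fun k => (if P i then F i k else 0) + \sum_(j <- r | P j) F j k.
  by apply/funext => k; rewrite big_cons; case: (P i); rewrite ?add0r.
by apply: smoothKD => //; case: (P i) => //; exact: smoothK_cst.
Qed.

Lemma smoothK_prod (I : Type) (r : seq I) (P : pred I) (F : I -> Ugrp R m -> R[i]) :
  (forall i, smoothK (F i)) -> smoothK (fun k => \prod_(i <- r | P i) F i k).
Proof.
move=> hF; elim: r => [|i r IH].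
  have -> : (fun k => \prod_(i <- [::] | P i) F i k) = fun=> 1.
    by apply/funext => k; rewrite big_nil.
  exact: smoothK_cst.
have -> : (fun k => \prod_(j <- i :: r | P j) F j k) =
    fun k => (if P i then F i k else 1) * \prod_(j <- r | P j) F j k.
  by apply/funext => k; rewrite big_cons; case: (P i); rewrite ?mul1r.
by apply: smoothKM => //; case: (P i) => //; exact: smoothK_cst.
Qed.

Lemma smoothK_det p (F : 'I_p -> 'I_p -> Ugrp R m -> R[i]) :
  (forall i j, smoothK (F i j)) -> smoothK (fun k => \det (\matrix_(i, j) F i j k)).
Proof.
move=> hF.
have -> : (fun k => \det (\matrix_(i, j) F i j k)) =
    fun k => \sum_(s : 'S_p) (-1) ^+ s * \prod_i F i (s i) k.
  apply/funext => k; apply: eq_bigr => s _; congr (_ * _).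
  by apply: eq_bigr => i _; rewrite mxE.
apply: smoothK_sum => s; apply: smoothKM; first exact: smoothK_cst.
exact: smoothK_prod.
Qed.

End SmoothOnGroup.

(** * Reproducing kernels of finite families *)

(** A row outside the span of the rows already chosen raises the rank, which is at most [p]. Hence
    finitely many points suffice, however large [T] is. *)
Lemma finite_spanning_rows (F : fieldType) (T : Type) p (v : T -> 'rV[F]_p) :
  exists r (h : 'I_r -> T), forall t, (v t <= \matrix_(i < r) v (h i))%MS.
Proof.
suff H d : (exists r (h : 'I_r -> T), forall t, (v t <= \matrix_(i < r) v (h i))%MS) \/
    exists r (h : 'I_r -> T), (d <= \rank (\matrix_(i < r) v (h i)))%N.
  have [//|[r [h]]] := H p.+1.
  by move=> /leq_trans/(_ (rank_leq_col _)); rewrite ltnn.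
elim: d => [|d [IH|[r [h hd]]]]; [|by left|].
  by have h0 : 'I_0 -> T by [case]; right; exists 0%N, h0.
have [|] := pselect (forall t, (v t <= \matrix_(i < r) v (h i))%MS).
  by left; exists r, h.
move=> /existsNP[t /negP ht]; right.
pose h' (i : 'I_(1 + r)) := match fintype.split i with inl _ => t | inr j => h j end.
exists (1 + r)%N, h'.
have -> : \matrix_(i < 1 + r) v (h' i) = col_mx (v t) (\matrix_(i < r) v (h i)).
  apply/row_matrixP => i; rewrite rowK /h'; case: (fintype.splitP i) => j ij.
    have -> : i = lshift r j by exact: val_inj.
    by rewrite rowKu (ord1 j) row_id.
  have -> : i = rshift 1 j by apply: val_inj; rewrite /= ij.
  by rewrite rowKd rowK.
apply: leq_ltn_trans hd _; rewrite -addsmxE; apply: rank_ltmx.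
rewrite /ltmx addsmxSr; apply: contra ht; exact/submx_trans/addsmxSl.
Qed.

Section KernelSpan.
Variables (R : realType) (T : Type) (J : finType) (e : J -> T -> R[i]).

(* The span of a finite family is also the span of the sections of its
   reproducing kernel: if E is the matrix of values of the family on finitely many
   points carrying all linear relations, then E E^* has the same rank as E. *)
Lemma kernel_sections_span (x : J -> R[i]) :
  exists r (h : 'I_r -> T) (y : 'I_r -> R[i]), forall k,
    \sum_j x j * e j k = \sum_i y i * \sum_j e j k * (e j (h i))^*.
Proof.
pose v k : 'rV[R[i]]_#|J| := \row_j e (enum_val j) k.
have [r [h hh]] := finite_spanning_rows v.
pose E : 'M[R[i]]_(r, #|J|) := \matrix_(i < r) v (h i).
pose E_ := map_mx Num.conj E.
pose X : 'rV_#|J| := \row_j x (enum_val j).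
(* If u = z E_ and u E^T = 0, then u times its conjugate transpose vanishes. This is a sum of
   squared moduli, so u = 0. *)
have kerE : (E_ :&: kermx E^T)%MS = 0.
  apply/eqP; rewrite -submx0; apply/rV_subP => u; rewrite sub_capmx => /andP[uE].
  move=> /sub_kermxP uK; rewrite submx0.
  have /submxP[z uz] := uE.
  have uu : \sum_j u 0 j * (u 0 j)^* = 0.
    transitivity ((u *m (map_mx Num.conj u)^T) 0 0).
      by rewrite mxE; apply: eq_bigr => j _; rewrite !mxE.
    rewrite {2}uz map_mxM /E_ -map_mx_comp.
    have -> : map_mx (Num.conj \o Num.conj) E = E.
      by apply/matrixP => i j; rewrite !mxE /= conjCK.
    by rewrite trmx_mul mulmxA uK mul0mx mxE.
  apply/eqP/rowP => j; rewrite mxE; apply/eqP.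
  have : u 0 j * (u 0 j)^* = 0 by apply: (psumr_eq0P (fun j _ => mul_conjC_ge0 (u 0 j)) uu).
  by move/eqP; rewrite mul_conjC_eq0.
have rk : \rank (E_ *m E^T) = \rank E^T.
  have := mxrank_mul_ker E_ E^T; rewrite kerE mxrank0 addn0 => ->.
  by rewrite mxrank_map mxrank_tr.
(* One row space contains the other and the ranks agree, so X E^T = y E_ E^T. The relation then
   extends to every point, whose row of values is a combination of the rows of [E]. *)
have : (X *m E^T <= E_ *m E^T)%MS.
  apply: submx_trans (submxMl _ _) _.
  by have [_ <-] := mxrank_leqif_sup (submxMl E_ E^T); rewrite rk.
move=> /submxP[y Ey]; exists r, h, (fun i => y 0 i) => k.
have /submxP[z vz] := hh k.
have tr (x' : J -> R[i]) : \sum_j x' j * e j k = (\row_j x' (enum_val j) *m (v k)^T) 0 0.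
  rewrite mxE (reindex (enum_val : 'I_#|J| -> J)) /=; last exact/onW_bij/enum_val_bij.
  by apply: eq_bigr => j _; rewrite !mxE.
rewrite tr -/X vz -/E trmx_mul mulmxA Ey -!mulmxA -trmx_mul -vz mxE.
apply: eq_bigr => i _; congr (_ * _); rewrite mxE.
rewrite [RHS](reindex (enum_val : 'I_#|J| -> J)) /=; last exact/onW_bij/enum_val_bij.
by apply: eq_bigr => j _; rewrite !mxE mulrC.
Qed.

End KernelSpan.

(** * Torus characters *)

Section Torus.
Variables (R : realType) (m : nat).
Implicit Types (d : 'rV[R[i]]_m) (mu nu : 'I_m -> int).

Definition unit_row d := forall a, `|d 0 a| = 1.

Definition torus_char d mu : R[i] := \prod_a d 0 a ^ mu a.

Lemma conjC_unit (z : R[i]) : `|z| = 1 -> z^* = z^-1.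
Proof. by move=> h; rewrite invC_norm h expr1n invr1 mul1r. Qed.

Lemma ctmxM (A B : 'M[R[i]]_m) : ctmx (A *m B) = ctmx B *m ctmx A.
Proof. by rewrite /ctmx map_mxM trmx_mul. Qed.

Lemma ctmxK : involutive (@ctmx R m).
Proof. by move=> A; apply/matrixP => i j; rewrite !mxE conjCK. Qed.

Lemma unitary_mxV (A : 'M[R[i]]_m) : unitary_mx A -> ctmx A *m A = 1%:M.
Proof. exact: mulmx1C. Qed.

Lemma unitary_ctmx (A : 'M[R[i]]_m) : unitary_mx A -> unitary_mx (ctmx A).
Proof. by move=> hA; rewrite /unitary_mx ctmxK unitary_mxV. Qed.

Definition Uinv (k : Ugrp R m) : Ugrp R m :=
  exist _ (ctmx (proj1_sig k)) (unitary_ctmx (proj2_sig k)).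

Lemma unitary_1 : unitary_mx (1%:M : 'M[R[i]]_m).
Proof. by rewrite /unitary_mx /ctmx map_mx1 trmx1 mulmx1. Qed.

Lemma ctmx_perm (s : 'S_m) : ctmx (perm_mx s : 'M[R[i]]_m) = perm_mx s^-1.
Proof. by rewrite /ctmx map_perm_mx tr_perm_mx. Qed.

Lemma unitary_perm (s : 'S_m) : unitary_mx (perm_mx s : 'M[R[i]]_m).
Proof. by rewrite /unitary_mx ctmx_perm -perm_mxM mulgV perm_mx1. Qed.

Lemma ctmx_diag d : ctmx (diag_mx d) = diag_mx (\row_a (d 0 a)^*).
Proof.
apply/matrixP => i j; rewrite !mxE eq_sym; case: eqP => [->|_].
  by rewrite !mulr1n.
by rewrite !mulr0n rmorph0.
Qed.

Lemma unitary_diag d : unit_row d <-> unitary_mx (diag_mx d).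
Proof.
rewrite /unitary_mx ctmx_diag mulmx_diag -diag_const_mx; split => [hd|].
  by congr diag_mx; apply/rowP => a; rewrite !mxE -normCK hd expr1n.
move=> /matrixP h a; have := h a a.
rewrite !mxE eqxx !mulr1n -normCK => /eqP; rewrite -[X in _ == X](expr1n _ 2).
by rewrite eqrXn2 // => /eqP.
Qed.

Definition Utorus d (hd : unit_row d) : Ugrp R m :=
  exist _ (diag_mx d) ((unitary_diag d).1 hd).

Lemma diag_Ugrp (t : Ugrp R m) : is_diag_mx (proj1_sig t) ->
  exists2 d, unit_row d & proj1_sig t = diag_mx d.
Proof.
move=> /diag_mxP[d td]; exists d => //.
by apply/unitary_diag; rewrite -td; exact: proj2_sig t.
Qed.

Lemma torus_charD d mu nu : unit_row d ->
  torus_char d (fun a => mu a + nu a) = torus_char d mu * torus_char d nu.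
Proof.
move=> hd; rewrite /torus_char -big_split; apply: eq_bigr => a _ /=.
by rewrite expfzDr // -normr_eq0 hd oner_eq0.
Qed.

(** At a coordinate where the weights differ by p in absolute value, take a p-th root of -1, and 1
    at all other coordinates: the two characters then differ by the factor -1. *)
Lemma torus_separates mu nu : ~ (mu =1 nu) ->
  exists2 d, unit_row d & torus_char d mu != torus_char d nu.
Proof.
move=> /existsNP[a /eqP hne].
wlog hlt : mu nu hne / mu a < nu a.
  move=> H; have [lt|gt|/eqP] := ltrgtP (mu a) (nu a); last by rewrite (negbTE hne).
    exact: H.
  by have [|d hd E] := H nu mu _ gt; [rewrite eq_sym | exists d; rewrite // eq_sym].
pose p := absz (nu a - mu a).
have p0 : (0 < p)%N by rewrite absz_gt0 subr_eq0 gt_eqF.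
pose z : R[i] := p.-root (-1).
have zp : z ^+ p = -1 by rewrite rootCK.
have z1 : `|z| = 1.
  by apply/eqP; rewrite -(pexpr_eq1 p0 (normr_ge0 z)) -normrX zp normrN1.
exists (\row_b (if b == a then z else 1)).
  by move=> b; rewrite mxE; case: eqP => _; rewrite ?normr1.
have E (la : 'I_m -> int) : torus_char (\row_b (if b == a then z else 1)) la = z ^ la a.
  rewrite /torus_char (bigD1 a) //= mxE eqxx big1 ?mulr1 // => b /negbTE h.
  by rewrite mxE h exp1rz.
have z0 : z != 0 by rewrite -normr_eq0 z1 oner_eq0.
rewrite !E -[nu a](subrK (mu a)) expfzDr // -[nu a - _]gez0_abs ?subr_ge0 1?ltW //.
rewrite -/p -exprnP zp mulN1r -subr_eq0 opprK -mulr2n mulrn_eq0 /=.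
exact: expfz_neq0.
Qed.

End Torus.

(** * Irreducibility of the span of a frame *)

Definition family_span (R : realType) m (J : finType) (e : J -> 'M[R[i]]_m -> R[i])
    (f : Kfun R m) : Prop :=
  exists x : J -> R[i], forall k, f k = \sum_j x j * e j (proj1_sig k).

(** Conditions that make the span of the [e j] irreducible of highest weight [Lam] and that survive
    pointwise products, so that they need checking only on minors. [frame_kernel] gives invariance
    under right translation. By [frame_left] all members share one left weight, which is [Lam] in
    the order [s] of the coordinates. [frame_top] says that the weight [Lam] has multiplicity at
    most one. *)
Record frame (R : realType) m (s : 'S_m) (J : finType) (e : J -> 'M[R[i]]_m -> R[i])
    (wt : J -> 'I_m -> int) (kappa : 'M[R[i]]_m -> R[i]) (Lam : 'I_m -> int) : Prop := Frame {
  frame_smooth : forall j, smoothK (iotaK (e j));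
  frame_kernel : forall k h, \sum_j e j k * (e j h)^* = kappa (k *m ctmx h);
  frame_one : kappa 1%:M != 0;
  frame_right : forall j d k, unit_row d ->
    e j (k *m diag_mx d) = torus_char d (wt j) * e j k;
  frame_left : forall j d k, unit_row d ->
    e j (diag_mx d *m k) = torus_char (\row_a d 0 (s a)) Lam * e j k;
  frame_dominated : forall j, dominated (wt j) Lam;
  frame_top : forall j, wt j =1 Lam -> exists c, forall k, e j k = c * kappa (k *m perm_mx s) }.

Section FrameSpan.
Variables (R : realType) (m : nat) (s : 'S_m) (J : finType) (e : J -> 'M[R[i]]_m -> R[i]).
Variables (wt : J -> 'I_m -> int) (kappa : 'M[R[i]]_m -> R[i]) (Lam : 'I_m -> int).
Hypothesis fr : frame s e wt kappa Lam.

Let V := family_span e.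

Definition kernel_section (h : Ugrp R m) : Kfun R m :=
  fun k => kappa (proj1_sig k *m ctmx (proj1_sig h)).

Lemma family_span_subspace : is_subspace V.
Proof.
split; first by exists (fun=> 0) => k; rewrite big1 // => j _; rewrite mul0r.
split=> [f g [x hx] [y hy]|c f [x hx]].
  exists (fun j => x j + y j) => k; rewrite hx hy -big_split.
  by apply: eq_bigr => j _; rewrite mulrDl.
exists (fun j => c * x j) => k; rewrite hx mulr_sumr.
by apply: eq_bigr => j _; rewrite mulrA.
Qed.

Lemma subspace_sum (S : Kfun R m -> Prop) (I : finType) (F : I -> Kfun R m) (c : I -> R[i]) :
  is_subspace S -> (forall i, S (F i)) -> S (fun k => \sum_i c i * F i k).
Proof.
move=> [S0 [SD SZ]] hF; elim: (index_enum I) => [|i r IH].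
  have -> : (fun k => \sum_(i <- [::]) c i * F i k) = fun=> 0.
    by apply/funext => k; rewrite big_nil.
  exact: S0.
have -> : (fun k => \sum_(j <- i :: r) c j * F j k) =
    fun k => c i * F i k + \sum_(j <- r) c j * F j k.
  by apply/funext => k; rewrite big_cons.
by apply: SD => //; exact: SZ.
Qed.

Lemma kernel_section_span h : V (kernel_section h).
Proof.
exists (fun j => (e j (proj1_sig h))^*) => k; rewrite /kernel_section -(frame_kernel fr).
by apply: eq_bigr => j _; rewrite mulrC.
Qed.

Lemma kernel_sections_generate f : V f ->
  exists r (h : 'I_r -> Ugrp R m) (y : 'I_r -> R[i]),
    f = fun k => \sum_i y i * kernel_section (h i) k.
Proof.
move=> [x hx].
have [r [h [y hy]]] := kernel_sections_span (fun j (k : Ugrp R m) => e j (proj1_sig k)) x.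
exists r, h, y; apply/funext => k; rewrite hx hy; apply: eq_bigr => i _.
by congr (_ * _); exact: (frame_kernel fr).
Qed.

(** Translating by [g] replaces [h] by h g^-1, so translations permute the kernel sections; the
    invariance of their span follows. *)
Lemma rtrans_kernel_section g h : rtrans g (kernel_section h) = kernel_section (Umul h (Uinv g)).
Proof. by apply/funext => k; rewrite /rtrans /kernel_section /= ctmxM ctmxK mulmxA. Qed.

Lemma family_span_invariant : is_Kinvariant V.
Proof.
move=> g f /kernel_sections_generate[r [h [y ->]]].
rewrite (_ : rtrans _ _ = fun k => \sum_i y i * kernel_section (Umul (h i) (Uinv g)) k).
  by apply: subspace_sum; [exact: family_span_subspace | move=> i; exact: kernel_section_span].
by apply/funext => k; apply: eq_bigr => i _; rewrite -rtrans_kernel_section.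
Qed.

Lemma family_span_findim : is_findim V.
Proof.
pose L := [seq iotaK (e j) | j <- enum J].
have sL : size L = #|J| by rewrite size_map cardE.
have nthL (j : 'I_(size L)) k : nth (fun=> 0) L j k =
    e (enum_val (cast_ord sL j)) (proj1_sig k).
  have hj : (j < size (enum J))%N by rewrite -cardE -sL.
  rewrite (nth_map (enum_val (cast_ord sL j))) // /iotaK.
  by rewrite -(enum_val_nth _ (cast_ord sL j)).
have bij : bijective (fun j => enum_val (cast_ord sL j) : J).
  apply: bij_comp; first exact: enum_val_bij.
  by exists (cast_ord (esym sL)); [exact: cast_ordK | exact: cast_ordKV].
have E (x : J -> R[i]) k : \sum_j x j * e j (proj1_sig k) =
    \sum_(j < size L) x (enum_val (cast_ord sL j)) * nth (fun=> 0) L j k.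
  rewrite (reindex (fun j => enum_val (cast_ord sL j))) /=; last exact: onW_bij.
  by apply: eq_bigr => j _; rewrite nthL.
exists L => f; split.
  move=> [x hx]; exists (fun j => x (enum_val (cast_ord sL j))).
  by apply/funext => k; rewrite hx E.
move=> [c ->]; have [b bK Kb] := bij; exists (fun j => c (b j)) => k; rewrite E.
by apply: eq_bigr => j _; rewrite bK.
Qed.

Lemma separating_torus mu : exists t : J -> 'rV[R[i]]_m, forall j, unit_row (t j) /\
  (~ (wt j =1 mu) -> torus_char (t j) mu != torus_char (t j) (wt j)).
Proof.
have H j : exists d : 'rV[R[i]]_m, unit_row d /\
    (~ (wt j =1 mu) -> torus_char d mu != torus_char d (wt j)).
  have [E|ne] := pselect (wt j =1 mu).
    by exists (const_mx 1); split => // a; rewrite mxE normr1.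
  have [d hd dne] := torus_separates R ne.
  by exists d; split => // _; rewrite eq_sym.
by have [t ht] := choice H; exists t.
Qed.

(* The product over j of the operators R_(t j) - (t j)^(wt j) kills every e_j whose
   weight is not mu. *)
Lemma weight_projection (S : Kfun R m -> Prop) x mu : is_subspace S ->
  (forall d (hd : unit_row d) f, S f -> S (rtrans (Utorus hd) f)) ->
  S (fun k => \sum_j x j * e j (proj1_sig k)) ->
  S (fun k => \sum_(j | `[<wt j =1 mu>]) x j * e j (proj1_sig k)).
Proof.
move=> [S0 [SD SZ]] St Sx; have [t ht] := separating_torus mu.
(* [del i j] is the eigenvalue on [e j] of the i-th operator, which is taken to be the identity when
   [wt i] is [mu]. *)
pose del i j : R[i] := if `[<wt i =1 mu>] then 1
  else torus_char (t i) (wt j) - torus_char (t i) (wt i).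
have step r : S (fun k => \sum_j (\prod_(i <- r) del i j) * (x j * e j (proj1_sig k))).
  elim: r => [|i r IH].
    move: Sx; congr S; apply/funext => k.
    by apply: eq_bigr => j _; rewrite big_nil mul1r.
  have E (k : Ugrp R m) : \sum_j (\prod_(i0 <- i :: r) del i0 j) * (x j * e j (proj1_sig k)) =
      \sum_j del i j * ((\prod_(i0 <- r) del i0 j) * (x j * e j (proj1_sig k))).
    by apply: eq_bigr => j _; rewrite big_cons -mulrA.
  rewrite (funext E); have [w|w] := boolP `[<wt i =1 mu>].
    move: IH; congr S; apply/funext => k; apply: eq_bigr => j _.
    by rewrite {2}/del w mul1r.
  move: IH; set g := (X in S X) => Sg; have [hd _] := ht i.
  have := SD _ _ (St _ hd _ Sg) (SZ (- torus_char (t i) (wt i)) _ Sg).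
  congr S; apply/funext => k; rewrite /rtrans /g /= mulr_sumr -big_split.
  apply: eq_bigr => j _ /=; rewrite (frame_right fr) // {3}/del (negbTE w) mulrBl mulNr.
  by congr (_ - _); rewrite !mulrA; congr (_ * _); rewrite mulrC mulrA.
(* The whole product acts by this scalar on each [e j] of weight [mu]; on any other [e j] the factor
   with i = j is zero. *)
pose c : R[i] := \prod_(i <- index_enum J) (if `[<wt i =1 mu>] then 1
  else torus_char (t i) mu - torus_char (t i) (wt i)).
have c0 : c != 0.
  apply/prodf_neq0 => i _; case: ifP => [_|/asboolPn ne]; first exact: oner_neq0.
  by rewrite subr_eq0; apply: (ht i).2.
have := SZ c^-1 _ (step (index_enum J)); congr S; apply/funext => k.
rewrite mulr_sumr [RHS]big_mkcond; apply: eq_bigr => j _; case: asboolP => [E|ne].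
  have -> : \prod_(i <- index_enum J) del i j = c.
    apply: eq_bigr => i _; rewrite /del; case: ifP => // _; congr (_ - _).
    by apply: eq_bigr => a _; rewrite E.
  by rewrite mulKf.
rewrite (bigD1 j) //= /del; case: asboolP => // _.
by rewrite subrr !mul0r mulr0.
Qed.

(** The element w of the overview. Its kernel section is the function k -> kappa (k [perm_mx s]) of
    [frame_top]. *)
Definition top_point : Ugrp R m := exist _ (perm_mx s^-1) (unitary_perm R (s^-1)%g).

(** A diagonal matrix moved across the permutation matrix acts on [e j] by [wt j] from the right and
    by [Lam] from the left; if these characters differ, the value must be 0. *)
Lemma vanish_at_top_point j : ~ (wt j =1 Lam) -> e j (perm_mx s^-1) = 0.
Proof.
move=> ne; have [d hd dne] := torus_separates R ne.
have E : perm_mx s^-1 *m diag_mx d = diag_mx (\row_a d 0 (s^-1 a)%g) *m perm_mx s^-1.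
  apply/matrixP => a b; rewrite mul_mx_diag mul_diag_mx !mxE.
  by case: eqP => [->|]; rewrite ?mulr1 ?mul1r // mulr0 mul0r.
have := frame_right fr j (perm_mx s^-1) hd.
rewrite E (frame_left fr); last by move=> a; rewrite mxE.
have -> : \row_a (\row_a0 d 0 (s^-1 a0)%g) 0 (s a) = d.
  by apply/rowP => a; rewrite !mxE permK.
move/eqP; rewrite -subr_eq0 -mulrBl mulf_eq0 subr_eq0 eq_sym (negbTE dne).
by move/eqP.
Qed.

Lemma family_span_irreducible : is_irreducible V.
Proof.
pose u : Ugrp R m := exist _ _ (unitary_1 R m).
have V1 : kernel_section u u <> 0.
  by rewrite /kernel_section /= mul1mx /ctmx map_mx1 trmx1; apply/eqP; exact: frame_one fr.
split; last split.
- split; first exact: family_span_subspace.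
  by split; [exact: family_span_invariant | exact: family_span_findim].
- by exists (kernel_section u); split; [exact: kernel_section_span | exists u].
move=> S' Ssub Sinv SV.
have [|/existsNP[f /not_implyP[Sf /existsNP[k0 fk0]]]] :=
  pselect (forall f, S' f -> forall k, f k = 0); first by left.
(* The translate of [f] whose value at [top_point] is the nonzero number [f k0]. *)
right; pose g := rtrans (Umul (Uinv top_point) k0) f.
have Sg : S' g by exact: Sinv.
have [x gx] := SV _ Sg.
have gw : g top_point = f k0.
  (* Expanding in the [e j] shows that [f] depends only on the underlying matrix, so the unitarity
     proofs carried by the group elements need not be compared. *)
  have [y fy] := SV _ Sf; rewrite /g /rtrans !fy; apply: eq_bigr => j _.
  by rewrite /= mulmxA (unitary_perm _ _) mul1mx.
have H j : exists c, wt j =1 Lam -> forall k, e j k = c * kappa (k *m perm_mx s).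
  have [E|ne] := pselect (wt j =1 Lam); last by exists 0.
  by have [c hc] := frame_top fr E; exists c.
have [c hc] := choice H.
pose A := \sum_(j | `[<wt j =1 Lam>]) x j * c j.
(* The component of [g] of weight [Lam] stays in [S'], and by [frame_top] it is [A] times the
   section at [top_point]. *)
have Sh : S' (fun k => A * kernel_section top_point k).
  have /(_ Lam) := weight_projection (x := x) _ Ssub (fun d hd f => Sinv (Utorus hd) f).
  have <- : g = fun k => \sum_j x j * e j (proj1_sig k) by apply/funext.
  move=> /(_ Sg); congr S'; apply/funext => k; rewrite /A mulr_suml.
  apply: eq_bigr => j /asboolP E; rewrite (hc j E) mulrA /kernel_section /=.
  by rewrite ctmx_perm invgK.
(* The components of other weights vanish at [top_point], so the nonzero value of [g] there forces
   [A] to be nonzero. *)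
have gA : g top_point = A * kernel_section top_point top_point.
  rewrite gx (bigID (fun j => `[<wt j =1 Lam>])) /= [X in _ + X]big1 ?addr0; last first.
    by move=> j /asboolPn ne; rewrite vanish_at_top_point ?mulr0.
  rewrite /A mulr_suml; apply: eq_bigr => j /asboolP E.
  by rewrite (hc j E) /kernel_section /= ctmx_perm invgK mulrA.
have A0 : A != 0 by apply/eqP => A0; apply: fk0; rewrite -gw gA A0 mul0r.
have [_ [_ SZ]] := Ssub.
have Sw : S' (kernel_section top_point).
  by move: (SZ A^-1 _ Sh); congr S'; apply/funext => k; rewrite mulKf.
have Ssec h : S' (kernel_section h).
  have := Sinv (Umul (Uinv h) top_point) _ Sw; rewrite rtrans_kernel_section.
  congr S'; apply/funext => k.
  by rewrite /kernel_section /= ctmxM ctmxK -(mulmxA (ctmx _)) (unitary_perm _ _) mulmx1.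
move=> f' /kernel_sections_generate[r [h [y ->]]]; exact: subspace_sum.
Qed.

(** If no [wt j] equals [mu], the product over i of the operators R_(t i) - (t i)^(wt i) kills every
    [e j] but multiplies a vector of weight [mu] by a nonzero scalar, so this vector is 0. *)
Lemma family_span_weight mu : is_weight V mu -> exists j, wt j =1 mu.
Proof.
move=> [f [[x fx] [[k0 fk0] fmu]]]; apply: contrapT => /forallNP nomu; apply: fk0.
have [t ht] := separating_torus mu.
have tmu d (hd : unit_row d) k : f (Umul k (Utorus hd)) = torus_char d mu * f k.
  rewrite fmu /=; last exact: diag_mx_is_diag.
  by congr (_ * _); apply: eq_bigr => a _; rewrite mxE eqxx mulr1n.
have step r k : (\prod_(i <- r) (torus_char (t i) mu - torus_char (t i) (wt i))) * f k =
    \sum_j (\prod_(i <- r) (torus_char (t i) (wt j) - torus_char (t i) (wt i))) *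
      (x j * e j (proj1_sig k)).
  elim: r k => [|i r IH] k.
    by rewrite big_nil mul1r fx; apply: eq_bigr => j _; rewrite big_nil mul1r.
  have [hd _] := ht i.
  transitivity (\prod_(i <- r) (torus_char (t i) mu - torus_char (t i) (wt i)) *
      f (Umul k (Utorus hd)) - torus_char (t i) (wt i) *
      (\prod_(i <- r) (torus_char (t i) mu - torus_char (t i) (wt i)) * f k)).
    by rewrite tmu big_cons -mulrA mulrBl; congr (_ - _); rewrite mulrCA.
  rewrite !IH mulr_sumr -sumrB; apply: eq_bigr => j _.
  by rewrite /= (frame_right fr) // (mulrCA (x j)) [X in X - _]mulrCA -mulrBl big_cons !mulrA.
have c0 : \prod_i (torus_char (t i) mu - torus_char (t i) (wt i)) != 0.
  by apply/prodf_neq0 => i _; rewrite subr_eq0; apply: (ht i).2.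
apply: (mulfI c0); rewrite step mulr0; apply: big1 => j _.
by rewrite (bigD1 j) //= subrr !mul0r.
Qed.

Lemma family_span_highest_weight : irr_highest_weight V Lam.
Proof.
split; first exact: family_span_irreducible.
split; last first.
  move=> mu /family_span_weight[j E]; have [h1 h2] := frame_dominated fr j.
  by split => [i im|]; [rewrite -(eq_bigr _ (fun a _ => E a)); exact: h1 |
    rewrite -(eq_bigr _ (fun a _ => E a))].
(* In the expansion of this section the coefficient of [e j] is the conjugate of the value of [e j]
   at [top_point], so only members of weight [Lam] occur. *)
exists (kernel_section top_point); split; first exact: kernel_section_span.
split.
  exists top_point; rewrite /kernel_section /= (unitary_perm _ _).
  by apply/eqP; exact: frame_one fr.
move=> t k /diag_Ugrp[d hd td].
have -> : \prod_a proj1_sig t a a ^ Lam a = torus_char d Lam.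
  by apply: eq_bigr => a _; rewrite td mxE eqxx mulr1n.
rewrite /kernel_section /= td -!(frame_kernel fr) mulr_sumr; apply: eq_bigr => j _.
have [E|ne] := pselect (wt j =1 Lam); last first.
  by rewrite vanish_at_top_point // conjC0 !mulr0.
rewrite (frame_right fr) // mulrA; congr (_ * _ * _).
by apply: eq_bigr => a _; rewrite E.
Qed.

End FrameSpan.

(** * Frames of minors *)

Lemma dominatedD m (mu nu Lam Mu : 'I_m -> int) : dominated mu Lam -> dominated nu Mu ->
  dominated (fun a => mu a + nu a) (fun a => Lam a + Mu a).
Proof.
move=> [h1 h2] [h3 h4]; split=> [j jm|]; rewrite !big_split /=; last by rewrite h2 h4.
by apply: lerD; [exact: h1 | exact: h3].
Qed.

(** Equality of the sums forces equality in each inequality of partial sums, and the partial sums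
    determine a weight. Thus a product of members has the top weight only if both factors do. *)
Lemma dominatedD_eq m (mu nu Lam Mu : 'I_m -> int) : dominated mu Lam -> dominated nu Mu ->
  (forall a, mu a + nu a = Lam a + Mu a) -> mu =1 Lam /\ nu =1 Mu.
Proof.
move=> [h1 _] [h2 _] E.
have S j : (j <= m)%N -> \sum_(a < m | (a < j)%N) mu a = \sum_(a < m | (a < j)%N) Lam a.
  move=> jm; apply/eqP; rewrite eq_le h1 //=.
  have /= : \sum_(a < m | (a < j)%N) (mu a + nu a) = \sum_(a < m | (a < j)%N) (Lam a + Mu a).
    by apply: eq_bigr.
  rewrite !big_split /= => sumE.
  by rewrite -(lerD2r (\sum_(a < m | (a < j)%N) nu a)) sumE lerD2l h2.
have split_last (la : 'I_m -> int) (a : 'I_m) :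
    \sum_(b < m | (b < a.+1)%N) la b = la a + \sum_(b < m | (b < a)%N) la b.
  rewrite (bigD1 a) //=; congr (_ + _); apply: eq_bigl => b.
  by rewrite ltnS -val_eqE /= [RHS]ltn_neqAle andbC.
have EL : mu =1 Lam.
  move=> a; have := S a.+1 (ltn_ord a); rewrite !split_last (S a (ltnW (ltn_ord a))).
  exact: addIr.
by split=> // a; have := E a; rewrite EL; exact: addrI.
Qed.

Definition framed (R : realType) m (s : 'S_m) (Lam : 'I_m -> int) (F : 'M[R[i]]_m -> R[i]) :=
  exists (J : finType) e wt kappa, frame s (J := J) e wt kappa Lam /\
    exists x : J -> R[i], forall Z, F Z = \sum_j x j * e j Z.

Section Framed.
Variables (R : realType) (m : nat) (s : 'S_m).
Implicit Types (Lam Mu : 'I_m -> int) (F G : 'M[R[i]]_m -> R[i]).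

Lemma framed_1 : framed (R := R) s (fun=> 0) (fun=> 1).
Proof.
exists unit, (fun _ _ => 1), (fun _ _ => 0), (fun=> 1); split; last first.
  by exists (fun=> 1) => Z; rewrite (big_pred1 tt) ?mulr1 // => -[].
have tor0 d : torus_char d (fun _ : 'I_m => 0) = 1 :> R[i].
  by apply: big1 => a _; rewrite expr0z.
split=> //.
- by move=> _; exact: smoothK_cst.
- by move=> k h; rewrite (big_pred1 tt) ?conjC1 ?mulr1 // => -[].
- by move=> _ d k hd; rewrite tor0 mulr1.
- by move=> _ d k hd; rewrite tor0 mulr1.
- by move=> _ _; exists 1 => k; rewrite mulr1.
Qed.

(** This realizes the Cartan product: kernels multiply, weights add, and the top weight still has
    multiplicity at most one by [dominatedD_eq]. *)
Lemma frameM (J1 J2 : finType) e1 e2 w1 w2 k1 k2 Lam Mu :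
  frame (R := R) s (J := J1) e1 w1 k1 Lam -> frame s (J := J2) e2 w2 k2 Mu ->
  frame s (fun (j : J1 * J2) Z => e1 j.1 Z * e2 j.2 Z) (fun j a => w1 j.1 a + w2 j.2 a)
    (fun Z => k1 Z * k2 Z) (fun a => Lam a + Mu a).
Proof.
move=> f1 f2; split.
- by move=> j; apply: smoothKM; [exact: frame_smooth f1 _ | exact: frame_smooth f2 _].
- move=> k h; rewrite -(frame_kernel f1) -(frame_kernel f2) big_distrlr /= pair_bigA /=.
  by apply: eq_bigr => -[a b] _ /=; rewrite rmorphM mulrACA.
- by rewrite mulf_neq0 ?(frame_one f1) ?(frame_one f2).
- move=> j d k hd; rewrite (frame_right f1) // (frame_right f2) //.
  by rewrite torus_charD // mulrACA.
- move=> j d k hd; rewrite (frame_left f1) // (frame_left f2) //.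
  have hsd : unit_row (\row_a d 0 (s a)) by move=> a; rewrite mxE.
  by rewrite torus_charD // mulrACA.
- by move=> j; apply: dominatedD; [exact: frame_dominated f1 _ | exact: frame_dominated f2 _].
move=> j E.
have [E1 E2] := dominatedD_eq (frame_dominated f1 j.1) (frame_dominated f2 j.2) E.
have [c1 h1] := frame_top f1 E1; have [c2 h2] := frame_top f2 E2.
by exists (c1 * c2) => k; rewrite h1 h2 mulrACA.
Qed.

Lemma framedM Lam Mu F G : framed s Lam F -> framed s Mu G ->
  framed s (fun a => Lam a + Mu a) (fun Z => F Z * G Z).
Proof.
move=> [J1 [e1 [w1 [k1 [f1 [x1 hx1]]]]]] [J2 [e2 [w2 [k2 [f2 [x2 hx2]]]]]].
do 4 eexists; split; first exact: frameM f1 f2.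
exists (fun j => x1 j.1 * x2 j.2) => Z; rewrite hx1 hx2 big_distrlr /= pair_bigA /=.
by apply: eq_bigr => -[a b] _ /=; rewrite mulrACA.
Qed.

Lemma framedX Lam F p : framed s Lam F ->
  framed s (fun a => Lam a *+ p) (fun Z => F Z ^+ p).
Proof.
move=> hF; elim: p => [|p IH]; first exact: framed_1.
have := framedM hF IH; congr framed; apply/funext => x; first by rewrite mulrS.
by rewrite exprS.
Qed.

Lemma framed_prod p (Lam : 'I_p -> 'I_m -> int) (F : 'I_p -> 'M[R[i]]_m -> R[i]) :
  (forall i, framed s (Lam i) (F i)) ->
  framed s (fun a => \sum_i Lam i a) (fun Z => \prod_i F i Z).
Proof.
move=> hF; elim: (index_enum _) => [|i r IH].
  have := framed_1; congr framed; apply/funext => x; by rewrite big_nil.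
by have := framedM (hF i) IH; congr framed; apply/funext => x; rewrite big_cons.
Qed.

End Framed.

(** * The Cauchy-Binet formula *)

Lemma det_colsub_perm (K : comNzRingType) k p (A : 'M[K]_(k, p)) (g : 'I_k -> 'I_p) (t : 'S_k) :
  \det (\matrix_(i, j) A i (g (t j))) = (-1) ^+ t * \det (\matrix_(i, j) A i (g j)).
Proof.
have -> : \matrix_(i, j) A i (g (t j)) = col_perm t (\matrix_(i, j) A i (g j)).
  by apply/matrixP => i j; rewrite !mxE.
by rewrite col_permE det_mulmx det_perm odd_permV mulrC.
Qed.

(** The sum runs over all maps instead of k-element subsets: maps that are not injective contribute
    0, and each subset is met k! times, whence the factor. *)
Lemma cauchy_binet (K : comNzRingType) k p (A : 'M[K]_(k, p)) (B : 'M[K]_(p, k)) :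
  \sum_(f : {ffun 'I_k -> 'I_p})
     \det (\matrix_(i, j) A i (f j)) * \det (\matrix_(i, j) B (f i) j) =
  k`!%:R * \det (A *m B).
Proof.
pose D (f : 'I_k -> 'I_p) := \det (\matrix_(i, j) B (f i) j).
have DT f : D f = \det (\matrix_(i, j) B^T i (f j)).
  by rewrite /D -det_tr; congr (\det _); apply/matrixP => i j; rewrite !mxE.
have -> : \det (A *m B) = \sum_(f : {ffun 'I_k -> 'I_p}) (\prod_i A i (f i)) * D f.
  under [RHS]eq_bigr do rewrite mulr_sumr.
  rewrite exchange_big; apply: eq_bigr => t _ /=.
  under eq_bigr do rewrite mxE.
  rewrite bigA_distr_bigA mulr_sumr; apply: eq_bigr => f _ /=.
  rewrite mulrCA big_split; congr (_ * (_ * _)).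
  by apply: eq_bigr => i _; rewrite mxE.
under eq_bigr do rewrite mulr_suml.
rewrite exchange_big /= -(card_Sn k).
rewrite -sum1_card natr_sum mulr_suml; apply: eq_big => [t|t _]; first by rewrite inE.
rewrite mul1r.
(* For the term of [t] in the expansion of the first determinant, replacing f by f composed with
   t^-1 removes [t] from the product of entries of [A] and produces a second sign, which cancels the
   first. *)
pose sh (u : 'S_k) (f : {ffun 'I_k -> 'I_p}) := [ffun i => f (u i)].
rewrite (reindex_inj (h := sh t^-1%g)); last first.
  apply: (can_inj (g := sh t)) => f; apply/ffunP => i.
  by rewrite !ffunE permK.
apply: eq_bigr => f _.
have -> : \prod_i (\matrix_(i, j) A i (sh t^-1%g f j)) i (t i) = \prod_i A i (f i).
  by apply: eq_bigr => i _; rewrite !mxE ffunE permK.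
have -> : \det (\matrix_(i, j) B (sh t^-1%g f i) j) = (-1) ^+ t * D f.
  rewrite -/(D _) !DT -(odd_permV t) -det_colsub_perm; congr (\det _).
  by apply/matrixP => i j; rewrite !mxE ffunE.
by rewrite mulrACA -signr_addb addbb mul1r.
Qed.

(** * The frame formed by the minors on fixed rows *)

Section Minors.
Variables (R : realType) (m k : nat) (s : 'S_m) (b : bool) (c : 'I_k -> 'I_m).
Hypothesis c_inj : injective c.

(** The flag [b] treats minors and conjugated minors together; on the unit torus conjugation negates
    the weights, hence [opp_if]. *)
Definition conj_if (z : R[i]) : R[i] := if b then z^* else z.
Definition opp_if (z : int) : int := if b then - z else z.

Definition minor_if (x : {ffun 'I_k -> 'I_m}) (Z : 'M[R[i]]_m) : R[i] :=
  conj_if (\det (\matrix_(i, j) Z (s (c i)) (x j))).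

Definition col_mult (x : 'I_k -> 'I_m) (a : 'I_m) : int := \sum_i (x i == a)%:Z.

(* A minor with a repeated column vanishes, so that any weight may be assigned to it. *)
Definition minor_weight (x : {ffun 'I_k -> 'I_m}) (a : 'I_m) : int :=
  opp_if (if injectiveb x then col_mult x a else col_mult c a).

Definition minor_kernel (M : 'M[R[i]]_m) : R[i] :=
  conj_if (k`!%:R * \det (\matrix_(i, j) M (s (c i)) (s (c j)))).

Lemma conj_ifM z w : conj_if (z * w) = conj_if z * conj_if w.
Proof. by rewrite /conj_if; case: b; rewrite ?rmorphM. Qed.

Lemma conj_if_conj z : conj_if z^* = (conj_if z)^*.
Proof. by rewrite /conj_if; case: b. Qed.

Lemma conj_if_sum (I : finType) (F : I -> R[i]) : conj_if (\sum_i F i) = \sum_i conj_if (F i).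
Proof. by rewrite /conj_if; case: b; rewrite ?rmorph_sum. Qed.

Lemma minor_if_eq0 (x : {ffun 'I_k -> 'I_m}) Z : ~~ injectiveb x -> minor_if x Z = 0.
Proof.
move=> /injectivePn[i [j ij xij]]; rewrite /minor_if -det_tr.
rewrite (determinant_alternate ij) => [|a]; last by rewrite !mxE xij.
by rewrite /conj_if conjC0 if_same.
Qed.

Lemma torus_char_col_mult d (x : 'I_k -> 'I_m) : unit_row d ->
  torus_char d (fun a => opp_if (col_mult x a)) = conj_if (\prod_i d 0 (x i)).
Proof.
move=> hd; have -> : \prod_i d 0 (x i) = torus_char d (col_mult x).
  rewrite /torus_char; under [RHS]eq_bigr => a _.
    rewrite /col_mult -(rmorph_sum Posz) /= -exprnP -prodrXr; over.
  rewrite exchange_big; apply: eq_bigr => i _ /=.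
  by rewrite (bigD1 (x i)) //= eqxx expr1 big1 ?mulr1 // => a /negbTE; rewrite eq_sym => ->.
rewrite /torus_char /conj_if /opp_if; case: b => //; rewrite rmorph_prod.
apply: eq_bigr => a _.
by rewrite -exprz_inv fmorphXz -(conjC_unit (hd a)).
Qed.

Lemma col_mult_gt0 (x : 'I_k -> 'I_m) a : (exists i, x i = a) <-> col_mult x a != 0.
Proof.
split=> [[i <-]|].
  by rewrite /col_mult (bigD1 i) //= eqxx gt_eqF // ltr_pwDl // sumr_ge0.
move=> h; apply: contrapT => /forallNP no; move: h; rewrite /col_mult big1 ?eqxx // => i _.
by case: eqP => // /no.
Qed.

(** Every value of [x] is also a value of [y]; a choice of preimages is injective because [x] is,
    hence a permutation. *)
Lemma same_col_mult (x y : 'I_k -> 'I_m) : injective x -> col_mult x =1 col_mult y ->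
  exists p : 'S_k, forall i, x i = y (p i).
Proof.
move=> xinj E; have H i : exists j, x i = y j.
  have /col_mult_gt0 : exists j, x j = x i by exists i.
  by rewrite E => /col_mult_gt0[j yj]; exists j.
have [p hp] := choice H.
have pinj : injective p by move=> i j pij; apply: xinj; rewrite !hp pij.
by exists (perm pinj) => i; rewrite permE hp.
Qed.

Hypothesis c_dominates : forall x : 'I_k -> 'I_m, injective x ->
  dominated (fun a => opp_if (col_mult x a)) (fun a => opp_if (col_mult c a)).

(** The fixed rows give the common left weight and the varying columns give the right weights. The
    kernel identity is Cauchy-Binet, and minors of top weight differ only by the order of their
    columns. *)
Lemma minor_frame :
  frame s minor_if minor_weight minor_kernel (fun a => opp_if (col_mult c a)).
Proof.
split.
- move=> x; have H : smoothK (fun k : Ugrp R m =>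
      \det (\matrix_(i, j) (proj1_sig k) (s (c i)) (x j))).
    by apply: smoothK_det => i j; exact: smoothK_entry.
  by rewrite /iotaK /minor_if /conj_if; case: b => //; exact: smoothK_conj.
- move=> Z h; transitivity (conj_if (\sum_(x : {ffun 'I_k -> 'I_m})
      \det (\matrix_(i, j) (\matrix_(i, a) Z (s (c i)) a) i (x j)) *
      \det (\matrix_(i, j) (\matrix_(a, j) (h (s (c j)) a)^*) (x i) j))).
    rewrite conj_if_sum; apply: eq_bigr => x _; rewrite conj_ifM /minor_if -conj_if_conj.
    congr (conj_if _ * conj_if _).
      by congr (\det _); apply/matrixP => i j; rewrite !mxE.
    rewrite -det_tr -det_map_mx; congr (\det _).
    by apply/matrixP => i j; rewrite !mxE.
  rewrite cauchy_binet /minor_kernel; congr (conj_if (_ * \det _)).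
  by apply/matrixP => i j; rewrite !mxE; apply: eq_bigr => a _; rewrite !mxE.
- have -> : minor_kernel 1%:M = conj_if k`!%:R.
    congr conj_if; rewrite -[RHS]mulr1; congr (_ * _); rewrite -[RHS](det1 _ k).
    congr (\det _); apply/matrixP => i j; rewrite !mxE.
    by rewrite (inj_eq (inj_comp perm_inj c_inj)).
  have k0 : k`!%:R != 0 :> R[i] by rewrite pnatr_eq0 -lt0n fact_gt0.
  by rewrite /conj_if; case: b => //; rewrite conjC_eq0.
- move=> x d Z hd; have [xinj|xninj] := boolP (injectiveb x); last first.
    by rewrite !minor_if_eq0 // mulr0.
  rewrite /minor_weight xinj torus_char_col_mult // -conj_ifM; congr conj_if.
  have -> : \matrix_(i, j) (Z *m diag_mx d) (s (c i)) (x j) =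
      (\matrix_(i, j) Z (s (c i)) (x j)) *m diag_mx (\row_i d 0 (x i)).
    by apply/matrixP => i j; rewrite mxE !mul_mx_diag !mxE.
  rewrite det_mulmx det_diag mulrC; congr (_ * _).
  by apply: eq_bigr => i _; rewrite mxE.
- move=> x d Z hd; rewrite torus_char_col_mult => [|a]; last by rewrite mxE.
  rewrite -conj_ifM; congr conj_if.
  have -> : \matrix_(i, j) (diag_mx d *m Z) (s (c i)) (x j) =
      diag_mx (\row_i d 0 (s (c i))) *m (\matrix_(i, j) Z (s (c i)) (x j)).
    by apply/matrixP => i j; rewrite mxE !mul_diag_mx !mxE.
  rewrite det_mulmx det_diag; congr (_ * _).
  by apply: eq_bigr => i _; rewrite !mxE.
- move=> x; rewrite /minor_weight; case: injectiveP => [xinj|_]; exact: c_dominates.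
move=> x E; have [xinj|xninj] := boolP (injectiveb x); last first.
  by exists 0 => Z; rewrite minor_if_eq0 // mul0r.
have {}E : col_mult x =1 col_mult c.
  move=> a; have := E a; rewrite /minor_weight xinj /opp_if.
  by case: b => //; exact: oppr_inj.
have [p xp] := same_col_mult (injectiveP x xinj) E.
have k0 : k`!%:R != 0 :> R[i] by rewrite pnatr_eq0 -lt0n fact_gt0.
(* The sign reorders the columns of [x] into those of [c]; the division removes the factor k! of
   [minor_kernel]. *)
exists (conj_if ((-1) ^+ p / k`!%:R)) => Z.
rewrite -conj_ifM mulrA divfK //; congr conj_if.
have -> : \det (\matrix_(i, j) (Z *m perm_mx s) (s (c i)) (s (c j))) =
    \det (\matrix_(i, j) (\matrix_(i, a) Z (s (c i)) a) i (c j)).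
  congr (\det _); apply/matrixP => i j; rewrite !mxE (bigD1 (c j)) //= !mxE eqxx mulr1.
  by rewrite big1 ?addr0 // => a /negbTE ne; rewrite !mxE (inj_eq perm_inj) ne mulr0.
rewrite -det_colsub_perm; congr (\det _).
by apply/matrixP => i j; rewrite !mxE xp.
Qed.

End Minors.

(** * Dominance between sets of columns *)

Section ColumnCounts.
Variables (m k : nat).

Definition cols_below (x : 'I_k -> 'I_m) (j : nat) : nat := #|[set i | (x i < j)%N]|.

Lemma col_mult_partial (x : 'I_k -> 'I_m) j :
  \sum_(a < m | (a < j)%N) col_mult x a = (cols_below x j)%:Z.
Proof.
rewrite exchange_big /cols_below -sum1_card (big_morph Posz PoszD (erefl _)) /=.
rewrite [RHS]big_mkcond; apply: eq_bigr => i _; rewrite inE.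
case: ifP => h.
  by rewrite (bigD1 (x i)) //= eqxx big1 // => a /andP[_ /negbTE]; rewrite eq_sym => ->.
by rewrite big1 // => a; case: eqP => // <-; rewrite h.
Qed.

Lemma col_mult_total (x : 'I_k -> 'I_m) : \sum_(a < m) col_mult x a = k%:Z.
Proof.
rewrite exchange_big /=; transitivity (\sum_(i < k) 1%:Z).
  apply: eq_bigr => i _.
  by rewrite (bigD1 (x i)) //= eqxx big1 // => a /negbTE; rewrite eq_sym => ->.
by rewrite sumr_const card_ord natz.
Qed.

Lemma cols_below_all (x : 'I_k -> 'I_m) j : (forall i, (x i < j)%N) -> cols_below x j = k.
Proof.
by move=> h; rewrite -[RHS]card_ord; apply: eq_card => i; rewrite !inE h.
Qed.

Lemma cols_below_inj (x : 'I_k -> 'I_m) j : injective x -> (j <= m)%N ->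
  (cols_below x j <= minn k j)%N.
Proof.
move=> xinj jm; rewrite leq_min -{1}[k]card_ord max_card /=.
have cj : #|[set a : 'I_m | (a < j)%N]| = j.
  rewrite -sum1_card (eq_bigl (fun a : 'I_m => (a < j)%N)) => [|a]; last by rewrite inE.
  by rewrite (big_ord_narrow jm) sum1_card card_ord.
rewrite -[X in (_ <= X)%N]cj /cols_below -(card_imset _ xinj); apply: subset_leq_card.
by apply/fintype.subsetP => _ /imsetP[i + ->]; rewrite !inE.
Qed.

Lemma cols_below_rev (x : 'I_k -> 'I_m) j : (j <= m)%N ->
  (cols_below (fun i => rev_ord (x i)) (m - j) + cols_below x j)%N = k.
Proof.
move=> jm; rewrite addnC -[RHS]card_ord -(cardsC [set i | (x i < j)%N]); congr addn.
by apply: eq_card => i; rewrite !inE /=; have := ltn_ord (x i); lia.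
Qed.

Hypothesis km : (k <= m)%N.
Let w := widen_ord km.

Lemma cols_below_widen j : (j <= m)%N -> cols_below w j = minn k j.
Proof.
move=> jm; case: (leqP k j) => kj.
  by apply: cols_below_all => i /=; exact: leq_trans (ltn_ord i) kj.
rewrite /cols_below -sum1_card (eq_bigl (fun a : 'I_k => (a < j)%N)) => [|a].
  by rewrite (big_ord_narrow (ltnW kj)) sum1_card card_ord.
by rewrite inE.
Qed.

(** The partial sums count chosen columns below j. At most min(k, j) distinct columns lie there, and
    the first k columns attain this bound. *)
Lemma widen_dominates (x : 'I_k -> 'I_m) : injective x ->
  dominated (fun a => opp_if false (col_mult x a)) (fun a => opp_if false (col_mult w a)).
Proof.
move=> xinj; split=> [j jm|]; rewrite /opp_if ?col_mult_total //.
by rewrite !col_mult_partial cols_below_widen // lez_nat cols_below_inj.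
Qed.

(** Conjugation negates the weights, so the extremal choice has the fewest columns below each j: the
    last k. Reversing the columns reduces this to the previous count. *)
Lemma rev_widen_dominates (x : 'I_k -> 'I_m) : injective x ->
  dominated (fun a => opp_if true (col_mult x a))
            (fun a => opp_if true (col_mult (fun i => rev_ord (w i)) a)).
Proof.
move=> xinj; split=> [j jm|]; rewrite /opp_if ?sumrN ?col_mult_total // lerN2.
rewrite !col_mult_partial lez_nat.
have := cols_below_rev x jm; have := cols_below_rev (fun i => rev_ord (w i)) jm.
have -> : (fun i => rev_ord (rev_ord (w i))) = w by apply/funext => i; rewrite rev_ordK.
rewrite cols_below_widen ?leq_subr //.
have := @cols_below_inj (fun i => rev_ord (x i)) (m - j) _ (leq_subr _ _).
move=> /(_ (inj_comp rev_ord_inj xinj)); lia.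
Qed.

Lemma col_mult_widen a : col_mult w a = (a < k)%N%:Z.
Proof.
case: ltnP => h.
  rewrite /col_mult (bigD1 (Ordinal h)) //= big1 => [|i]; last first.
    by rewrite -!val_eqE /= => /negbTE ->.
  by rewrite -val_eqE /= eqxx addr0.
by apply: big1 => i _; rewrite -val_eqE /= ltn_eqF // (leq_trans (ltn_ord i)).
Qed.

Lemma col_mult_rev_widen a : col_mult (fun i => rev_ord (w i)) a = (m - a.+1 < k)%N%:Z.
Proof.
rewrite -[(m - _)%N]/(val (rev_ord a)) -col_mult_widen; apply: eq_bigr => i _.
by rewrite (can2_eq rev_ordK rev_ordK).
Qed.

End ColumnCounts.

(** * Minors and Gram determinants as members of frame spans *)

Section FramedMinors.
Variables (R : realType) (m : nat) (s : 'S_m).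

Lemma framed_ext Lam Mu (F G : 'M[R[i]]_m -> R[i]) : framed s Lam F ->
  Lam =1 Mu -> F =1 G -> framed s Mu G.
Proof. by move=> h /funext <- /funext <-. Qed.

Lemma frame_sum (J I : finType) e wt kappa Lam (g : I -> J) (al : I -> R[i]) :
  frame s e wt kappa Lam -> framed s Lam (fun Z => \sum_i al i * e (g i) Z).
Proof.
move=> fr; exists J, e, wt, kappa; split => //; exists (fun j => \sum_(i | g i == j) al i) => Z.
rewrite (partition_big g xpredT) //=; apply: eq_bigr => j _.
by rewrite mulr_suml; apply: eq_bigr => i /eqP ->.
Qed.

Lemma frame_member (J : finType) e wt kappa Lam (j : J) (al : R[i]) :
  frame s e wt kappa Lam -> framed s Lam (fun Z => al * e j Z).
Proof.
move=> fr; apply: framed_ext (frame_sum (fun=> j) (fun _ : 'I_1 => al) fr) _ _ => //.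
by move=> Z; rewrite big_ord1.
Qed.

Variables (k : nat) (km : (k <= m)%N).
Let w := widen_ord km.
Let rw (i : 'I_k) := rev_ord (w i).

Let w_inj : injective w.
Proof. by move=> i j [ij]; exact: val_inj. Qed.

Let rw_inj : injective rw.
Proof. by move=> i j /rev_ord_inj/w_inj. Qed.

Definition upper_frame := minor_frame R s w_inj (widen_dominates km).
Definition lower_frame := minor_frame R s rw_inj (rev_widen_dominates km).

Lemma framed_upper_minor (x : 'I_k -> 'I_m) :
  framed s (fun a => (a < k)%N%:Z)
    (fun Z : 'M[R[i]]_m => \det (\matrix_(i, j) Z (s (w i)) (x j))).
Proof.
apply: framed_ext (frame_member (finfun x) 1 upper_frame) _ _ => [a|Z].
  by rewrite /opp_if col_mult_widen.
rewrite mul1r /minor_if /conj_if; congr (\det _).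
by apply/matrixP => i j; rewrite !mxE ffunE.
Qed.

Lemma framed_lower_minor (x : 'I_k -> 'I_m) :
  framed s (fun a => - (m - a.+1 < k)%N%:Z)
    (fun Z : 'M[R[i]]_m => (\det (\matrix_(i, j) Z (s (rw i)) (x j)))^*).
Proof.
apply: framed_ext (frame_member (finfun x) 1 lower_frame) _ _ => [a|Z].
  by rewrite /opp_if col_mult_rev_widen.
rewrite mul1r /minor_if /conj_if; congr ((\det _)^*).
by apply/matrixP => i j; rewrite !mxE ffunE.
Qed.

(* Cauchy-Binet turns the determinant into a sum of products of an upper and a lower
   minor with the same columns. *)
Lemma framed_gram_minor p (x : 'I_p -> 'I_m) :
  framed s (fun a => (a < k)%N%:Z - (m - a.+1 < k)%N%:Z)
    (fun Z : 'M[R[i]]_m => \det (\matrix_(i < k, j < k)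
       \sum_(a < p) Z (s (w i)) (x a) * (Z (s (rw j)) (x a))^*)).
Proof.
(* Both minors use the same columns, chosen by [f] among those of [x]; the coefficient 1/k! below
   undoes the factor in Cauchy-Binet. *)
pose g (f : {ffun 'I_k -> 'I_p}) := ([ffun i => x (f i)], [ffun i => x (f i)]).
apply: framed_ext (frame_sum g (fun=> k`!%:R^-1) (frameM upper_frame lower_frame)) _ _ => [a|Z].
  by rewrite /opp_if col_mult_widen col_mult_rev_widen.
rewrite -mulr_sumr.
pose A := \matrix_(i < k, a < p) Z (s (w i)) (x a).
pose B := \matrix_(a < p, j < k) (Z (s (rw j)) (x a))^*.
have k0 : k`!%:R != 0 :> R[i] by rewrite pnatr_eq0 -lt0n fact_gt0.
apply: (mulfI k0); rewrite mulVKf //.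
transitivity (k`!%:R * \det (A *m B)).
  rewrite -cauchy_binet; apply: eq_bigr => f _; rewrite /minor_if /conj_if /=.
  congr (_ * _).
    by congr (\det _); apply/matrixP => i j; rewrite !mxE ffunE.
  rewrite -det_tr -det_map_mx; congr (\det _).
  by apply/matrixP => i j; rewrite !mxE ffunE.
congr (_ * \det _); apply/matrixP => i j; rewrite !mxE; apply: eq_bigr => a _.
by rewrite !mxE.
Qed.

End FramedMinors.

Section FramedDet.
Variables (R : realType) (m : nat) (s : 'S_m).

Lemma framedZ Lam (F : 'M[R[i]]_m -> R[i]) c : framed s Lam F -> framed s Lam (fun Z => c * F Z).
Proof.
move=> [J [e [wt [kappa [fr [x hx]]]]]]; exists J, e, wt, kappa; split => //.
exists (fun j => c * x j) => Z; rewrite hx mulr_sumr.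
by apply: eq_bigr => j _; rewrite mulrA.
Qed.

Lemma det_row_perm (p : 'S_m) (Z : 'M[R[i]]_m) :
  \det Z = (-1) ^+ p * \det (\matrix_(i, j) Z (p i) j).
Proof.
have -> : \matrix_(i, j) Z (p i) j = row_perm p Z by apply/matrixP => i j; rewrite !mxE.
by rewrite row_permE det_mulmx det_perm mulrA -signr_addb addbb mul1r.
Qed.

(** The determinant is the minor of full size with its rows in the order [s], up to the sign of [s].
    The conjugate is treated likewise with the reversed order. *)
Lemma framed_det : framed s (fun=> 1) (fun Z : 'M[R[i]]_m => \det Z).
Proof.
apply: framed_ext (framedZ ((-1) ^+ s) (framed_upper_minor R s (leqnn m) id)) _ _ => [a|Z].
  by rewrite ltn_ord.
rewrite [RHS](det_row_perm s); congr (_ * \det _); apply/matrixP => i j; rewrite !mxE.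
by congr (Z (s _) _); exact: val_inj.
Qed.

Lemma framed_conj_det : framed s (fun=> -1) (fun Z : 'M[R[i]]_m => \det (map_mx Num.conj Z)).
Proof.
pose p := (perm (@rev_ord_inj m) * s)%g.
apply: framed_ext (framedZ ((-1) ^+ p) (framed_lower_minor R s (leqnn m) id)) _ _ => [a|Z].
  by rewrite subnSK // leq_subr.
rewrite det_map_mx [in RHS](det_row_perm p) rmorphM rmorph_sign /=; congr (_ * (\det _)^*).
apply/matrixP => i j; rewrite !mxE permM permE.
by congr (Z (s _) _); exact: val_inj.
Qed.

End FramedDet.

(** * The functions F *)

Section RowOrder.
Variable n : nat.

Definition row_order_fun (a : nat) : nat :=
  if (a < n)%N then (2 * a)%N else (2 * (n + n - a.+1) + 1)%N.

Lemma row_order_subproof (a : 'I_(n + n)) : (row_order_fun a < n + n)%N.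
Proof. by rewrite /row_order_fun; have := ltn_ord a; case: ifP; lia. Qed.

Lemma row_order_inj : injective (fun a => Ordinal (row_order_subproof a)).
Proof.
move=> a b [] E; apply: val_inj => /=; move: E; rewrite /row_order_fun.
by have := ltn_ord a; have := ltn_ord b; case: ifP; case: ifP; lia.
Qed.

(* Lists the 0-based rows as 0, 2, ..., 2n-2, 2n-1, ..., 3, 1: in this order of the
   torus coordinates the left weight of the F's is dominant. *)
Definition row_order : 'S_(n + n) := perm row_order_inj.

Lemma row_order_val a : row_order a = row_order_fun a :> nat.
Proof. by rewrite permE. Qed.

End RowOrder.

Section Generators.
Variables (R : realType) (n : nat).
Let m := (n + n)%N.
Let s := row_order n.
Implicit Types Z : 'M[R[i]]_(n + n).

Lemma ent_ord p (Z : 'M[R[i]]_p) (i j : 'I_p) : ent Z i j = Z i j.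
Proof. by rewrite /ent !valK. Qed.

Lemma ent_eq p (Z : 'M[R[i]]_p) (a b : nat) (i j : 'I_p) : a = i -> b = j -> ent Z a b = Z i j.
Proof. by move=> -> ->; exact: ent_ord. Qed.

(** F_k is the determinant of the matrix of the [Phi]. In [row_order] its rows come from the first k
    positions and its conjugated rows from the last k read backwards, so it is a Gram minor over the
    first n columns. *)
Lemma framed_Fk k : (k <= n)%N ->
  framed (R := R) s (fun a => (a < k)%N%:Z - (m - a.+1 < k)%N%:Z) (Fk n k).
Proof.
move=> kn; have km : (k <= m)%N by rewrite /m; lia.
apply: framed_ext (framed_gram_minor R s km (lshift n)) _ _ => // Z.
apply: eq_bigr => t _; congr (_ * _); apply: eq_bigr => i _; rewrite mxE.
have := ltn_ord i; have := ltn_ord (t i) => hti hi.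
apply: eq_bigr => a _; congr (_ * _^*); apply/esym/ent_eq => //.
  by rewrite row_order_val /row_order_fun /=; case: ifP; lia.
by rewrite row_order_val /row_order_fun /= /m; case: ifP; lia.
Qed.

Lemma framed_Delta1p : framed (R := R) s (fun a => (a < n)%N%:Z) (fun Z => Delta1p n Z).
Proof.
have km : (n <= m)%N by rewrite /m; lia.
apply: framed_ext (framed_upper_minor R s km (lshift n)) _ _ => // Z.
congr (\det _); apply/matrixP => i j; rewrite !mxE; apply/esym/ent_eq => //.
by have := ltn_ord i; rewrite row_order_val /row_order_fun /=; case: ifP; lia.
Qed.

Lemma framed_Delta1m : framed (R := R) s (fun a => - (m - a.+1 < n)%N%:Z) (fun Z => Delta1m n Z).
Proof.
have km : (n <= m)%N by rewrite /m; lia.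
apply: framed_ext (framed_lower_minor R s km (lshift n)) _ _ => // Z.
rewrite -det_map_mx; congr (\det _); apply/matrixP => i j; rewrite !mxE.
congr (_^*); apply/esym/ent_eq => //.
by have := ltn_ord i; rewrite row_order_val /row_order_fun /= /m; case: ifP; lia.
Qed.

Lemma framedXz Lam (F : 'M[R[i]]_m -> R[i]) (z : int) : 0 <= z ->
  framed s Lam F -> framed s (fun a => Lam a * z) (fun Z => F Z ^ z).
Proof.
by case: z => // p _ hF; apply: framed_ext (framedX p hF) _ _ => // a; rewrite pmulrn mulrzz.
Qed.

(** Computes a coordinate of the weight of the product of the F_i with i < n; the subtracted last
    term is restored by the power of F_n. *)
Lemma telescope_tail (N : nat -> int) p a : (a <= p)%N ->
  \sum_(i < p) (a < i.+1)%N%:Z * (N i - N i.+1) = N a - N p.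
Proof.
elim: p => [|p IH] ap; first by rewrite big_ord0 (eqP (_ : a == 0)%N) ?subrr // -leqn0.
rewrite big_ord_recr /=; move: ap; rewrite leq_eqVlt => /orP[/eqP ->|ap].
  rewrite ltnn mul0r addr0 subrr big1 // => i _.
  by rewrite ltnS ltnNge (ltnW (ltn_ord i)) mul0r.
by rewrite IH // ap mul1r addrA subrK.
Qed.

(** The hypotheses on [N] make the exponents of the F_i nonnegative. These factors give N_i - |l+L|
    on the first n coordinates and, in reversed order, its negative on the last n. For either sign
    of l+L, the two determinant factors add |l+L| + L on the first half and -|l+L| + L on the
    second. *)
Lemma framed_FNlL (N : nat -> int) (l L : int) : (0 < n)%N ->
  (forall i, (i.+1 < n)%N -> N i.+1 <= N i) ->
  `|l + L| <= N n.-1 -> framed (R := R) s (LambdaW N L) (fun Z => FNlL N l L Z).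
Proof.
move=> n0 Nmon Nlast.
have fD1 : framed (R := R) s
    (fun a => if 0 <= l + L then - (m - a.+1 < n)%N%:Z * (2 * (l + L)) else
       (a < n)%N%:Z * - (2 * (l + L)))
    (fun Z => if 0 <= l + L then Delta1m n Z ^ (2 * (l + L)) else Delta1p n Z ^ (- (2 * (l + L)))).
  by case: (boolP (0 <= l + L)) => h; apply: framedXz; try lia;
    [exact: framed_Delta1m | exact: framed_Delta1p].
have fD2 : framed (R := R) s (fun a => l + 2 * L)
    (fun Z => if 0 <= l + 2 * L then Delta2p Z ^ (l + 2 * L) else Delta2m Z ^ (- (l + 2 * L))).
  case: (boolP (0 <= l + 2 * L)) => h.
    by apply: framed_ext (framedXz h (framed_det R s)) _ _ => // a; rewrite mul1r.
  have h' : 0 <= - (l + 2 * L) by lia.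
  by apply: framed_ext (framedXz h' (framed_conj_det R s)) _ _ => // a; rewrite mulN1r opprK.
have fF : framed (R := R) s
    (fun a => \sum_(i < n.-1) ((a < i.+1)%N%:Z - (m - a.+1 < i.+1)%N%:Z) * (N i - N i.+1))
    (fun Z => \prod_(i < n.-1) Fk n i.+1 Z ^ (N i - N i.+1)).
  apply: framed_prod => i; apply: framedXz; last by apply: framed_Fk; have := ltn_ord i; lia.
  by rewrite subr_ge0; apply: Nmon; have := ltn_ord i; lia.
have fn : framed (R := R) s
    (fun a => ((a < n)%N%:Z - (m - a.+1 < n)%N%:Z) * (N n.-1 - `|l + L|))
    (fun Z => Fk n n Z ^ (N n.-1 - `|l + L|)).
  by apply: framedXz; [rewrite subr_ge0 | exact: framed_Fk].
apply: framed_ext (framedM (framedM (framedM fF fn) fD1) fD2) _ _ => // a /=.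
under eq_bigr do rewrite mulrBl.
rewrite sumrB; have am := ltn_ord a; rewrite /LambdaW.
case: (ltnP a n) => an.
  rewrite (@telescope_tail N n.-1 a); last by lia.
  rewrite big1 => [|i _]; last first.
    by rewrite (_ : (_ < _)%N = false) ?mul0r //; have := ltn_ord i; rewrite /m; lia.
  rewrite (_ : (m - a.+1 < n)%N = false); last by rewrite /m; lia.
  case: (boolP (0 <= l + L)); lia.
rewrite big1 => [|i _]; last first.
  by rewrite (_ : (_ < _)%N = false) ?mul0r //; have := ltn_ord i; lia.
rewrite (@telescope_tail N n.-1 (m - a.+1)); last by rewrite /m; lia.
rewrite (_ : (m - a.+1 < n)%N); last by rewrite /m; lia.
rewrite /m; case: (boolP (0 <= l + L)); lia.
Qed.

End Generators.

(** * The left torus action and membership in the minimal K-type *)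

Section LeftEquivariance.
Variables (R : realType) (n : nat) (N : nat -> int) (L : int).

Lemma chi_unit (z : R[i]) k : `|z| = 1 -> chi k z = z ^ k.
Proof. by move=> h; rewrite /chi h divr1. Qed.

Lemma torus_char_LambdaW (d : 'rV[R[i]]_(n + n)) : unit_row d ->
  torus_char (\row_a d 0 (row_order n a)) (LambdaW N L) =
  \prod_(i < n) (chi (N i + L) (ent (diag_mx d) (2 * i) (2 * i)) *
                 chi (- N i + L) (ent (diag_mx d) (2 * i + 1) (2 * i + 1))).
Proof.
move=> hd; rewrite big_split /torus_char big_split_ord /=; congr (_ * _).
  apply: eq_bigr => i _; rewrite mxE.
  rewrite (@ent_eq _ _ _ _ _ (row_order n (lshift n i)) (row_order n (lshift n i))).
  - by rewrite mxE eqxx mulr1n chi_unit // /LambdaW /= ltn_ord.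
  - by rewrite row_order_val /row_order_fun /= ltn_ord.
  - by rewrite row_order_val /row_order_fun /= ltn_ord.
(* The second half is read backwards: position 2n-1-i carries the weight -N_i + L and corresponds to
   row 2i+1. *)
rewrite (reindex_inj rev_ord_inj); apply: eq_bigr => i _; rewrite mxE.
have E : (2 * i + 1)%N = row_order n (rshift n (rev_ord i)).
  by rewrite row_order_val /row_order_fun /=; have := ltn_ord i; case: ifP; lia.
rewrite (ent_eq _ E E) mxE eqxx mulr1n chi_unit // /LambdaW /=.
rewrite ltnNge leq_addr /=; congr (_ ^ (- N _ + L)).
by have := ltn_ord i; lia.
Qed.

(** The K-type is the span of the frame; it lies in pi_K because all its members are smooth and
    share the prescribed left weight. *)
Lemma framed_in_Ktype (F : 'M[R[i]]_(n + n) -> R[i]) :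
  framed (row_order n) (LambdaW N L) F ->
  in_piK N L (iotaK F) /\ in_Ktype N L (iotaK F).
Proof.
move=> [J [e [wt [kappa [fr [x hx]]]]]].
have inV : family_span e (iotaK F) by exists x => k; exact: hx.
have sub g : family_span e g -> in_piK N L g.
  move=> [y gy]; split.
    rewrite (_ : g = fun k => \sum_j y j * e j (proj1_sig k)); last exact/funext.
    apply: smoothK_sum => j; apply: smoothKM; first exact: smoothK_cst.
    exact: (frame_smooth fr).
  move=> t k /diag_Ugrp[d hd td]; rewrite !gy td -torus_char_LambdaW // mulr_sumr.
  by apply: eq_bigr => j _; rewrite /= td (frame_left fr) // mulrCA.
split; first exact: sub.
by exists (family_span e); split => //; split => //; exact: family_span_highest_weight fr.
Qed.

End LeftEquivariance.

(** * Right translation by block diagonal unitary matrices *)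

Section RightEquivariance.
Variables (R : realType) (n : nat) (Z : 'M[R[i]]_(n + n)) (k1 k2 : 'M[R[i]]_n).
Hypotheses (u1 : unitary_mx k1) (u2 : unitary_mx k2).
Let g : 'M[R[i]]_(n + n) := block_mx k1 0 0 k2.

Lemma norm_det_unitary p (M : 'M[R[i]]_p) : unitary_mx M -> `|\det M| = 1.
Proof.
move=> hM; have : \det M * (\det M)^* = 1.
  by rewrite -(det1 _ p) -hM det_mulmx /ctmx det_tr det_map_mx.
by rewrite -normCK => /eqP; rewrite sqrp_eq1 // => /eqP.
Qed.

Lemma ent_block_mul a (j : 'I_n) : ent (Z *m g) a j = \sum_(c < n) ent Z a c * k1 c j.
Proof.
have [ha|ha] := ltnP a (n + n); last first.
  by rewrite /ent insubN -?leqNgt // big1 // => c _; rewrite mul0r.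
rewrite (@ent_eq _ _ _ _ _ (Ordinal ha) (lshift n j)) // mxE big_split_ord /=.
rewrite [X in _ + X]big1 ?addr0 => [|c _]; last by rewrite block_mxEdl mxE mulr0.
by apply: eq_bigr => c _; rewrite block_mxEul (@ent_eq _ _ _ _ _ (Ordinal ha) (lshift n c)).
Qed.

(** Only the first n columns enter [Phi] and the two [Delta1] determinants, and these columns are
    affected by [k1] alone. *)
Lemma left_half_block_mul p (r : 'I_p -> nat) :
  \matrix_(i < p, j < n) ent (Z *m g) (r i) j =
  (\matrix_(i < p, j < n) ent Z (r i) j) *m k1.
Proof.
apply/matrixP => i j; rewrite !mxE ent_block_mul.
by apply: eq_bigr => c _; rewrite mxE.
Qed.

(** [Phi] is the Hermitian product of two half rows, which the unitary matrix [k1] preserves. *)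
Lemma Phi_block a b : Phi n (Z *m g) a b = Phi n Z a b.
Proof.
pose u W c : 'rV[R[i]]_n := \row_j ent (W : 'M[R[i]]_(n + n)) c j.
have PhiE W : Phi n W a b = (u W a *m (map_mx Num.conj (u W b))^T) 0 0.
  by rewrite mxE; apply: eq_bigr => i _; rewrite !mxE.
have ug c : u (Z *m g) c = u Z c *m k1 by exact: (left_half_block_mul (fun=> c)).
by rewrite !PhiE !ug map_mxM trmx_mul mulmxA -(mulmxA _ k1) u1 mulmx1.
Qed.

Lemma Fk_block k : Fk n k (Z *m g) = Fk n k Z.
Proof.
by apply: eq_bigr => t _; congr (_ * _); apply: eq_bigr => i _; exact: Phi_block.
Qed.

Lemma Delta1p_block : Delta1p n (Z *m g) = Delta1p n Z * \det k1.
Proof. by rewrite /Delta1p left_half_block_mul det_mulmx. Qed.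

Lemma Delta1m_block : Delta1m n (Z *m g) = Delta1m n Z * (\det k1)^*.
Proof.
have E W : Delta1m n W = (\det (\matrix_(i < n, j < n) ent (W : 'M[R[i]]_(n + n)) (2 * i + 1) j))^*.
  by rewrite -det_map_mx; congr (\det _); apply/matrixP => i j; rewrite !mxE.
by rewrite !E left_half_block_mul det_mulmx rmorphM.
Qed.

Lemma Delta2p_block : Delta2p (Z *m g) = Delta2p Z * (\det k1 * \det k2).
Proof. by rewrite /Delta2p det_mulmx det_ublock. Qed.

Lemma Delta2m_block : Delta2m (Z *m g) = Delta2m Z * (\det k1 * \det k2)^*.
Proof. by rewrite /Delta2m !det_map_mx det_mulmx det_ublock -rmorphM. Qed.

(** Conjugating a number of modulus 1 inverts it, so each determinant factor transforms by one
    formula for both signs of its exponent. The exponent of det k1 is then -2(l+L) + (l+2L) = -l. *)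
Lemma FNlL_block (N : nat -> int) (l L : int) : FNlL N l L (Z *m g) =
  chi (- l) (\det k1) * chi (l + 2 * L) (\det k2) * FNlL N l L Z.
Proof.
have n1 := norm_det_unitary u1; have n2 := norm_det_unitary u2.
rewrite !chi_unit //; set a := \det k1 in n1 *; set b := \det k2 in n2 *.
have a0 : a != 0 by rewrite -normr_eq0 n1 oner_eq0.
have ab1 : `|a * b| = 1 by rewrite normrM n1 n2 mulr1.
pose D1 W := if 0 <= l + L then Delta1m n W ^ (2 * (l + L))
  else Delta1p n (W : 'M[R[i]]_(n + n)) ^ (- (2 * (l + L))).
pose D2 W := if 0 <= l + 2 * L then Delta2p W ^ (l + 2 * L)
  else Delta2m (W : 'M[R[i]]_(n + n)) ^ (- (l + 2 * L)).
have D1g : D1 (Z *m g) = D1 Z * a ^ (- (2 * (l + L))).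
  rewrite /D1 Delta1m_block Delta1p_block -/a conjC_unit // !expfzMl exprz_inv.
  by case: ifP.
have D2g : D2 (Z *m g) = D2 Z * (a * b) ^ (l + 2 * L).
  rewrite /D2 Delta2m_block Delta2p_block -/a -/b conjC_unit //.
  by case: ifP => _; rewrite [LHS]expfzMl // exprz_inv opprK.
pose P W := \prod_(i < n.-1) Fk n i.+1 (W : 'M[R[i]]_(n + n)) ^ (N i - N i.+1).
have Pg : P (Z *m g) = P Z by apply: eq_bigr => i _; rewrite Fk_block.
have FE W : FNlL N l L W = P W * Fk n n W ^ (N n.-1 - `|l + L|) * D1 W * D2 W by [].
have -> : a ^ (- l) * b ^ (l + 2 * L) = a ^ (- (2 * (l + L))) * (a * b) ^ (l + 2 * L).
  by rewrite expfzMl mulrA -(expfzDr _ _ a0); congr (a ^ _ * _); ring.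
by rewrite !FE Pg Fk_block D1g D2g; ring.
Qed.

End RightEquivariance.

Theorem theorem3p10 (R : realType) (n : nat) (N : nat -> int) (l L : int) :
  (0 < n)%N ->
  (forall i : nat, (i.+1 < n)%N -> N i.+1 <= N i) ->
  `|l + L| <= N n.-1 ->
  let f := iotaK (@FNlL R n N l L) in
  in_piK N L f /\
  in_Ktype N L f /\
  (forall (k : Ugrp R (n + n)) (k1 k2 : Ugrp R n) (g : Ugrp R (n + n)),
     proj1_sig g = block_mx (proj1_sig k1) 0 0 (proj1_sig k2) ->
     f (Umul k g) = chi (- l) (\det (proj1_sig k1)) * chi (l + 2 * L) (\det (proj1_sig k2)) * f k).
Proof.
move=> n0 Nmon Nlast f.
have [fpi ftau] := framed_in_Ktype (framed_FNlL R n0 Nmon Nlast).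
split=> //; split=> // k k1 k2 g gE; rewrite /f /iotaK /= gE.
by apply: FNlL_block; exact: proj2_sig.
Qed.
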